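(* The Baumslag-Solitar group $\mathrm{BS}(1,2)=\langle a,t\mid tat^{-1}=a^2\rangle$ is shortcut but not strongly shortcut. Moreover, $\mathrm{BS}(1,2)$ has a Cayley graph (with respect to a finite generating set) which is shortcut and a Cayley graph (with respect to a finite generating set) which is not shortcut.
   Context: Graphs are $1$-dimensional cell complexes with each edge isometric to $[0,1]$, with geodesic path metric $d_\Gamma$ (defined on all points). A cycle $C$ is a graph homeomorphic to a circle; $|C|$ is its number of edges. A cycle in a graph $\Gamma$ is a continuous map $f\colon C\to\Gamma$ sending vertices to vertices and each closed edge onto a closed edge (not necessarily injective). It is isometric if it is an isometric embedding; for $\xi\in(0,1)$ it is $\xi$-almost isometric if $d_\Gamma(f(p),f(q))\ge\xi\frac{|C|}{2}$ for every antipodal pair of points $p,q\in C$. A connected simplicial graph $\Gamma$ is shortcut if there is $\theta\in\mathbb{N}$ such that every isometric cycle $C\to\Gamma$ has $|C|\le\theta$; it is strongly shortcut if there are $\theta\in\mathbb{N}$ and $\xi\in(0,1)$ such that every $\xi$-almost isometric cycle has $|C|\le\theta$. A group is (strongly) shortcut if it acts properly and cocompactly on a (strongly) shortcut graph. *)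

(* Defs.v *)
From HB Require Import structures.
From mathcomp Require Import all_boot all_order all_algebra generic_quotient.
From mathcomp Require Import all_classical all_reals all_analysis.

Set Implicit Arguments.
Unset Strict Implicit.
Unset Printing Implicit Defensive.

Import Order.TTheory GRing.Theory Num.Theory.
Import numFieldNormedType.Exports.

Local Open Scope classical_set_scope.
Local Open Scope ring_scope.
Local Open Scope quotient_scope.

Section Presentation.
Context {X : choiceType}.

(* [(x, true)] stands for x and [(x, false)] for its inverse. *)
Definition word := seq (X * bool).
Definition inv_word (w : word) : word := rev [seq (l.1, ~~ l.2) | l <- w].

Inductive word_eq (rels : set word) : word -> word -> Prop :=
| WordRefl w : word_eq rels w w
| WordSym w1 w2 : word_eq rels w1 w2 -> word_eq rels w2 w1
| WordTrans w1 w2 w3 :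
    word_eq rels w1 w2 -> word_eq rels w2 w3 -> word_eq rels w1 w3
| WordCat w1 w2 w3 w4 :
    word_eq rels w1 w2 -> word_eq rels w3 w4 ->
    word_eq rels (w1 ++ w3) (w2 ++ w4)
| WordCancel x b : word_eq rels [:: (x, b); (x, ~~ b)] [::]
| WordRel r : rels r -> word_eq rels r [::].

Variable rels : set word.

Definition word_eqb (w1 w2 : word) : bool := `[< word_eq rels w1 w2 >].

Lemma word_eqb_refl : reflexive word_eqb.
Proof. by move=> w; apply/asboolP; exact: WordRefl. Qed.

Lemma word_eqb_sym : symmetric word_eqb.
Proof. by move=> w1 w2; apply/asboolP/asboolP; exact: WordSym. Qed.

Lemma word_eqb_trans : transitive word_eqb.
Proof.
by move=> w2 w1 w3 /asboolP h1 /asboolP h2; apply/asboolP; exact: WordTrans h2.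
Qed.

Canonical word_equiv := EquivRel word_eqb word_eqb_refl word_eqb_sym
  word_eqb_trans.

Definition presented := {eq_quot word_equiv}.
HB.instance Definition _ := Choice.on presented.

Definition pres_class (w : word) : presented := \pi_{eq_quot word_equiv} w.

Lemma pres_classP (w1 w2 : word) :
  pres_class w1 = pres_class w2 <-> word_eq rels w1 w2.
Proof.
rewrite /pres_class; split => [/eqquotP/asboolP //|h].
by apply/eqquotP/asboolP.
Qed.

Lemma pres_classE (x : presented) :
  pres_class (repr (x : {eq_quot word_equiv})) = x.
Proof. exact: reprK. Qed.

Lemma word_eq_repr (w : word) :
  word_eq rels (repr (pres_class w : {eq_quot word_equiv})) w.
Proof. by apply/pres_classP; rewrite pres_classE. Qed.

Lemma inv_word_cat w1 w2 : inv_word (w1 ++ w2) = inv_word w2 ++ inv_word w1.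
Proof. by rewrite /inv_word map_cat rev_cat. Qed.

Lemma inv_wordK : involutive inv_word.
Proof.
move=> w; rewrite /inv_word map_rev revK -map_comp map_id_in //.
by case=> x b _ /=; rewrite negbK.
Qed.

Lemma word_eq_mulV w : word_eq rels (w ++ inv_word w) [::].
Proof.
elim: w => [|[x b] w ih]; first exact: WordRefl.
rewrite -cat1s inv_word_cat -catA (catA w).
apply: (WordTrans (w2 := [:: (x, b)] ++ ([::] ++ inv_word [:: (x, b)]))).
  by apply: WordCat; [exact: WordRefl|apply: WordCat => //; exact: WordRefl].
exact: WordCancel.
Qed.

Lemma word_eq_Vmul w : word_eq rels (inv_word w ++ w) [::].
Proof. by have := word_eq_mulV (inv_word w); rewrite inv_wordK. Qed.

Lemma word_eq_inv w1 w2 :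
  word_eq rels w1 w2 -> word_eq rels (inv_word w1) (inv_word w2).
Proof.
move=> h; have R := @WordRefl rels.
apply: (WordTrans (w2 := inv_word w1 ++ (w2 ++ inv_word w2))).
  rewrite -[X in word_eq _ X]cats0; apply: WordCat => //.
  exact/WordSym/word_eq_mulV.
rewrite catA -[X in word_eq _ _ X]cat0s; apply: WordCat => //.
apply: WordTrans (word_eq_Vmul w1).
by apply: WordCat => //; exact: WordSym.
Qed.

Definition pres_one : presented := pres_class [::].
Definition pres_mul (x y : presented) : presented :=
  pres_class (repr (x : {eq_quot word_equiv}) ++
              repr (y : {eq_quot word_equiv})).
Definition pres_inv (x : presented) : presented :=
  pres_class (inv_word (repr (x : {eq_quot word_equiv}))).

Lemma pres_mulE w1 w2 :
  pres_mul (pres_class w1) (pres_class w2) = pres_class (w1 ++ w2).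
Proof. by apply/pres_classP; apply: WordCat; exact: word_eq_repr. Qed.

Lemma pres_invE w : pres_inv (pres_class w) = pres_class (inv_word w).
Proof. by apply/pres_classP; apply: word_eq_inv; exact: word_eq_repr. Qed.

Lemma pres_mulA : associative pres_mul.
Proof.
move=> x y z; rewrite -[x]pres_classE -[y]pres_classE -[z]pres_classE.
by rewrite !pres_mulE catA.
Qed.

Lemma pres_mul1 : left_id pres_one pres_mul.
Proof. by move=> x; rewrite -[x]pres_classE pres_mulE. Qed.

Lemma pres_mulr1 : right_id pres_one pres_mul.
Proof. by move=> x; rewrite -[x]pres_classE pres_mulE cats0. Qed.

Lemma pres_mulV : left_inverse pres_one pres_inv pres_mul.
Proof.
move=> x; rewrite -[x]pres_classE pres_invE pres_mulE.
exact/pres_classP/word_eq_Vmul.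
Qed.

Lemma pres_mulrV : right_inverse pres_one pres_inv pres_mul.
Proof.
move=> x; rewrite -[x]pres_classE pres_invE pres_mulE.
exact/pres_classP/word_eq_mulV.
Qed.

HB.instance Definition _ := isGroup.Build presented
  pres_mulA pres_mul1 pres_mulr1 pres_mulV pres_mulrV.

End Presentation.
Arguments word : clear implicits.
Arguments presented {X} rels.
Arguments pres_class {X} rels w.

(* Generators of BS(1,2): [true] is a and [false] is t; the relator is
   t a t^-1 a^-2. *)
Definition BS12_relator : word bool :=
  [:: (false, true); (true, true); (false, false); (true, false);
      (true, false)].

Definition BS12 : groupType := presented [set BS12_relator].

Record simple_graph := SimpleGraph {
  vertex :> choiceType;
  adj : rel vertex;
  adj_sym : symmetric adj;
  adj_irr : irreflexive adj }.

Definition connected_graph (Gam : simple_graph) : Prop :=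
  inhabited Gam /\
  forall u v : Gam, exists2 s, path (@adj Gam) u s & last u s = v.

(* Geometric realization, in barycentric coordinates: the point at distance
   1 - s from u on the edge uv is s u + (1 - s) v; u = v gives vertices. *)
Section Realization.
Variables (R : realType) (Gam : simple_graph).

Definition is_point (x : Gam -> R) : Prop :=
  exists u v (s : R), [/\ u = v \/ adj u v, 0 <= s <= 1 &
    forall w, x w = s * (w == u)%:R + (1 - s) * (w == v)%:R].

Record realization := Point { coord :> Gam -> R; coordP : is_point coord }.

HB.instance Definition _ := gen_eqMixin realization.
HB.instance Definition _ := gen_choiceMixin realization.

Lemma realization_eq (x y : realization) : x =1 y -> x = y.
Proof.
case: x y => [x xP] [y yP] /= /funext xy; move: yP; rewrite -xy => yP.
by congr Point; exact: Prop_irrelevance.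
Qed.

Lemma vertex_point_subproof (v : Gam) :
  is_point (fun w => (w == v)%:R).
Proof.
exists v, v, 1; split; [by left|by rewrite ler01 lexx|move=> w].
by rewrite mul1r subrr mul0r addr0.
Qed.

Definition vertex_point (v : Gam) : realization :=
  Point (vertex_point_subproof v).

Definition closed_edge (u v : Gam) : set realization :=
  [set x | forall w, x w != 0 -> w = u \/ w = v].

(* [segment_path x y l]: some concatenation of finitely many segments, each
   inside a closed edge, joins x to y and has total length l.  On the edge uv
   the coordinate at u is an isometric parametrization. *)
Inductive segment_path (x : realization) : realization -> R -> Prop :=
| SegmentNil : segment_path x x 0
| SegmentRcons y z l u v :
    segment_path x y l -> adj u v ->
    closed_edge u v y -> closed_edge u v z ->
    segment_path x z (l + `|y u - z u|).

Definition gdist (x y : realization) : R := inf [set l | segment_path x y l].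

(* In a connected graph this is [gdist x y < e]. *)
Definition gball (x : realization) (e : R) (y : realization) : Prop :=
  exists2 l, segment_path x y l & l < e.

Lemma segment_path_cat x y z l1 l2 : segment_path x y l1 ->
  segment_path y z l2 -> segment_path x z (l1 + l2).
Proof.
move=> xy; elim=> [|y' z' l u v _ ih uv ey ez]; first by rewrite addr0.
by rewrite addrA; exact: SegmentRcons uv ey ez.
Qed.

Lemma segment_path_sym x y l : segment_path x y l -> segment_path y x l.
Proof.
elim=> [|y' z' l' u v _ ih uv ey ez]; first exact: SegmentNil.
rewrite addrC; apply: segment_path_cat ih.
by rewrite distrC -[X in segment_path _ _ X]add0r;
  apply: SegmentRcons uv ez ey; exact: SegmentNil.
Qed.

Lemma gball_center x e : 0 < e -> gball x e x.
Proof. by exists 0 => //; exact: SegmentNil. Qed.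

Lemma gball_sym x y e : gball x e y -> gball y e x.
Proof. by case=> l xy le; exists l => //; exact: segment_path_sym. Qed.

Lemma gball_triangle x y z e1 e2 :
  gball x e1 y -> gball y e2 z -> gball x (e1 + e2) z.
Proof.
case=> l1 xy l1e [l2 yz l2e]; exists (l1 + l2); last exact: ltrD.
exact: segment_path_cat yz.
Qed.

HB.instance Definition _ :=
  hasNbhs.Build realization (nbhs_ (entourage_ gball)).
HB.instance Definition _ := Nbhs_isPseudoMetric.Build R realization
  erefl gball_center gball_sym gball_triangle erefl.

(* A cycle with n edges is modelled on C = R / nZ, with the integers as
   vertices: a map C -> Gam is an n-periodic map on R. *)
Definition is_cycle (n : nat) (f : R -> realization) : Prop :=
  [/\ (0 < n)%N,
      forall x, f (x + n%:R) = f x,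
      continuous f,
      forall i : int, range vertex_point (f i%:~R) &
      forall i : int, exists u v, adj u v /\
        f @` [set` `[i%:~R : R, (i + 1)%:~R]] = closed_edge u v].

Definition circle_dist (n : nat) (x y : R) : R :=
  inf (range (fun k : int => `|x - y + k%:~R * n%:R|)).

Definition isometric_cycle (n : nat) (f : R -> realization) : Prop :=
  is_cycle n f /\ forall x y, gdist (f x) (f y) = circle_dist n x y.

(* The point antipodal to x in R / nZ is x + n/2. *)
Definition almost_isometric_cycle (xi : R) (n : nat) (f : R -> realization) :
    Prop :=
  is_cycle n f /\ forall x, xi * (n%:R / 2) <= gdist (f x) (f (x + n%:R / 2)).

(* Meaningful for connected graphs only: connectedness is a separate hypothesis
   of [shortcut_group], and [cayley_connected] gives it for Cayley graphs. *)
Definition shortcut : Prop :=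
  exists theta : nat, forall n f, isometric_cycle n f -> (n <= theta)%N.

Definition strongly_shortcut : Prop :=
  exists (theta : nat) (xi : R), 0 < xi < 1 /\
    forall n f, almost_isometric_cycle xi n f -> (n <= theta)%N.

End Realization.

Section Action.
Variables (G : groupType) (Gam : simple_graph).

(* Actions by graph automorphisms, extended to the realization by
   [act_point]. *)
Record graph_action := GraphAction {
  act :> G -> Gam -> Gam;
  act1 : forall v, act 1%g v = v;
  actM : forall g h v, act (g * h)%g v = act g (act h v);
  act_adj : forall g u v, adj u v -> adj (act g u) (act g v) }.

Variables (R : realType) (A : graph_action).

Lemma actVE (g : G) (v w : Gam) : (A g^-1%g w == v) = (w == A g v).
Proof.
apply/eqP/eqP => [<-|->]; rewrite -actM ?mulgV ?mulVg act1 //.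
Qed.

Lemma act_point_subproof (g : G) (x : realization R Gam) :
  is_point (fun w => x (A g^-1%g w)).
Proof.
have [u [v [s [uv s01 xE]]]] := coordP x.
exists (A g u), (A g v), s; split => //.
  by case: uv => [->|/(act_adj A g) uv]; [left|right].
by move=> w; rewrite xE !actVE.
Qed.

Definition act_point (g : G) (x : realization R Gam) : realization R Gam :=
  Point (act_point_subproof g x).

Definition proper_action : Prop :=
  forall K : set (realization R Gam), compact K ->
    finite_set [set g : G | act_point g @` K `&` K !=set0].

Definition cocompact_action : Prop :=
  exists2 K : set (realization R Gam), compact K &
    \bigcup_(g in [set: G]) (act_point g @` K) = setT.

End Action.

Section ShortcutGroup.
Variables (R : realType) (G : groupType).

Definition acts_geometrically (Gam : simple_graph) : Prop :=
  exists A : graph_action G Gam, proper_action R A /\ cocompact_action R A.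

Definition shortcut_group : Prop :=
  exists Gam : simple_graph,
    [/\ connected_graph Gam, shortcut R Gam & acts_geometrically Gam].

Definition strongly_shortcut_group : Prop :=
  exists Gam : simple_graph,
    [/\ connected_graph Gam, strongly_shortcut R Gam &
        acts_geometrically Gam].

End ShortcutGroup.

Section Cayley.
Variable G : groupType.
Local Open Scope group_scope.

Definition generates (S : seq G) : Prop :=
  forall H : {pred G}, group_closed H -> {subset S <= H} -> forall g, g \in H.

Definition cayley_adj (S : seq G) : rel G :=
  fun g h => (g != h) && ((g^-1 * h \in S) || (h^-1 * g \in S)).

Lemma cayley_adj_sym S : symmetric (cayley_adj S).
Proof. by move=> g h; rewrite /cayley_adj eq_sym orbC. Qed.

Lemma cayley_adj_irr S : irreflexive (cayley_adj S).
Proof. by move=> g; rewrite /cayley_adj eqxx. Qed.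

(* The simplicial Cayley graph: loops and multiple edges are discarded. *)
Definition cayley (S : seq G) : simple_graph :=
  SimpleGraph (@cayley_adj_sym S) (@cayley_adj_irr S).

Lemma cayley_connected (S : seq G) :
  generates S -> connected_graph (cayley S).
Proof.
move=> gS; split; first exact: inhabits 1.
pose P (g : G) :=
  forall x : G, exists2 s, path (cayley_adj S) x s & last x s = x * g.
have PM g h : P g -> P h -> P (g * h).
  move=> Pg Ph x; have [s ps ls] := Pg x; have [s' ps' ls'] := Ph (x * g).
  exists (s ++ s'); first by rewrite cat_path ps ls.
  by rewrite last_cat ls ls' mulgA.
have P1 : P 1 by move=> x; exists [::]; rewrite //= mulg1.
have PS g : (g \in S) -> P g /\ P g^-1.
  have [-> _|g1 gS'] := eqVneq g 1; first by rewrite invg1.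
  have e1 (x : G) : (x == x * g) = false.
    apply/negbTE; apply: contra g1 => /eqP e; apply/eqP/(mulgI x).
    by rewrite mulg1.
  have e2 (x : G) : (x == x * g^-1) = false.
    apply/negbTE; apply: contra g1 => /eqP e; apply/eqP/(mulgI (x * g^-1)).
    by rewrite mulgVK mulg1.
  split=> x.
    by exists [:: x * g]; rewrite //= /cayley_adj e1 mulKg gS'.
  exists [:: x * g^-1]; rewrite //= /cayley_adj e2 invgM invgK.
  by rewrite -mulgA mulVg mulg1 gS' orbT.
pose H : {pred G} := [pred g | `[< P g /\ P g^-1 >]].
have HP : forall g, g \in H.
  apply: gS; last by move=> g /PS ?; apply/asboolP.
  split; first by apply/asboolP; rewrite invg1.
  move=> u v /asboolP[u1 u2] /asboolP[v1 v2]; apply/asboolP; split.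
    exact: PM.
  by rewrite invgF; exact: PM.
move=> u v; have /asboolP[h _] := HP (u^-1 * v).
by have [s p l] := h u; exists s => //; rewrite l mulgA mulgV mul1g.
Qed.

End Cayley.

(* Main.v *)
Require Import Defs.
From mathcomp Require Import all_boot all_order all_algebra generic_quotient.
From mathcomp Require Import all_classical.
From mathcomp Require Import all_reals all_analysis.
From mathcomp Require Import zify ring lra.

(** The group BS(1,2) is the group of affine maps x |-> 2^k x + b with b a
    dyadic rational, where t is x |-> 2 x and a is x |-> x + 1.  An element g
    is thus a point at abscissa [pos g] = b on the horizontal line of height
    [lev g] = k.  Right multiplication by a moves it by 2^k along its line,
    right multiplication by t moves it straight up, and left multiplication
    by an element of level 0 is a horizontal translation.  The
    abscissas of level k that agree modulo 2^k form one branch at that level, and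
    branches split in two on the way up, so that the group looks like a tree of
    hyperbolic half planes; to change b by an odd integer, a walk has to visit
    level 0 or lower.

    The Cayley graph for {a, t} is shortcut.  All horizontal edges of one level
    are translates of each other by one and the same left translation ([shear]),
    which is an isometry.  Hence, on an isometric cycle, two edges of the same
    level traversed in opposite directions are antipodal ([no_opposite_edge]),
    and a geodesic starting at a higher level has at most one horizontal edge
    at a given level ([geodesic_level_unique]): two opposite edges cancel after
    translating the part between them, and two parallel edges can be traded for
    a single edge one level up.  At its top level M a cycle has two consecutive
    parallel edges ([top_run]), hence no edge of level M in the other direction.
    Cut between these two edges, the rest of the cycle consists of two
    geodesics, along each of which the edges below level M move the abscissa by
    at most a sum of distinct powers of 2, less than 2^M ([segment_drift]).
    This cannot compensate the two edges of level M, so that an isometric cycle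
    has length at most 5.  Since this graph also carries the geometric action
    of the group by left multiplication, the group is shortcut.

    The Cayley graph for {t, at, a^-1 t} is not shortcut.  Every edge changes
    the level by one and the abscissa by -1, 0 or 1 times the smaller 2^k,
    so that short walks have small displacement ([walk_displacement]).  The
    cycle [long_cycle h] of length 4h goes up to level h and down to level 0,
    twice, drifting steadily to the right and then to the left and using
    different branches above level 0.  Antipodal vertices have equal levels,
    differ by an odd integer, and are far apart unless they are at level h, so
    that they are at distance 2h ([vertical_far]).  This makes the cycle
    isometric ([cycle_map_isometric]).

    No graph on which the group acts geometrically is strongly shortcut.  In
    a strongly shortcut graph a long closed walk has two antipodal points that
    are joined by a chord shorter than half of the walk by a definite factor
    ([short_chord]).  Cutting along chords repeatedly bounds, by a polynomial
    in the length, every quantity that is additive under cutting and bounded on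
    closed walks of bounded length ([area_polynomial]).  Such a quantity is the
    signed area of the image of the walk in the plane under
    g |-> (pos g, depth g), where [depth] is a coordinate supported on the
    branch of odd abscissas for which g and its neighbours lie in a box of size
    2^k by 2^-k, hence of bounded area ([box_move_ex]).  But the commutator of
    t^n a t^-n and a has length 4n + 4 and encloses area 2^n - 1
    ([word_area_commutator]).  A geometric action transports these estimates
    to the graph ([coarse_inverse]). *)

Set Implicit Arguments.
Unset Strict Implicit.
Unset Printing Implicit Defensive.

Import Order.TTheory GRing.Theory Num.Theory.
Import numFieldNormedType.Exports.

Local Open Scope classical_set_scope.
Local Open Scope ring_scope.
Local Open Scope quotient_scope.

(** * Affine coordinates on BS(1,2) *)

Definition gen_a : BS12 := pres_class _ [:: (true, true)].
Definition gen_t : BS12 := pres_class _ [:: (false, true)].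
Definition letter (l : bool * bool) : BS12 := pres_class _ [:: l].

Lemma pres_class_cons (l : bool * bool) (w : word bool) :
  pres_class [set BS12_relator] (l :: w) =
  (letter l * (pres_class [set BS12_relator] w : BS12))%g.
Proof. by rewrite -[l :: w]cat1s -pres_mulE. Qed.

Lemma letterE (l : bool * bool) :
  letter l = let x := if l.1 then gen_a else gen_t in if l.2 then x else x^-1%g.
Proof.
by case: l => [[] []] //=; rewrite /letter /gen_a /gen_t;
  apply/esym; exact: pres_invE.
Qed.

Lemma BS12_ind (P : BS12 -> Prop) :
  P 1%g ->
  (forall g, P g -> [/\ P (gen_a * g)%g, P (gen_a^-1 * g)%g,
                        P (gen_t * g)%g & P (gen_t^-1 * g)%g]) ->
  forall g, P g.
Proof.
move=> P1 PS g; rewrite -[g]pres_classE.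
elim: (repr _) => [//|l w ih]; rewrite pres_class_cons letterE.
by have [? ? ? ?] := PS _ ih; case: l => [[] []].
Qed.

Lemma BS12_relation : (gen_t * gen_a = gen_a * gen_a * gen_t)%g.
Proof.
suff h : (gen_t * gen_a * gen_t^-1 * gen_a^-1 * gen_a^-1 = 1)%g.
  move/divg1_eq: h => h; apply: (mulIg gen_t^-1%g); rewrite mulgK.
  by apply: (mulIg gen_a^-1%g); rewrite mulgK.
have e : pres_class [set BS12_relator] BS12_relator = 1%g :> BS12.
  by apply/pres_classP; exact: WordRel.
by rewrite -[RHS]e /BS12_relator !pres_class_cons !letterE /= mulg1 !mulgA.
Qed.

Section Affine.
Variable R : realType.

Definition aff_mul (x y : R * int) : R * int := (x.1 + 2 ^ x.2 * y.1, x.2 + y.2).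

Definition aff_letter (l : bool * bool) : R * int :=
  let s := if l.2 then 1 else -1 in if l.1 then (s%:~R, 0) else (0, s).

Definition aff_word (w : word bool) : R * int :=
  foldr (fun l => aff_mul (aff_letter l)) (0, 0) w.

Lemma aff_mulA : associative aff_mul.
Proof.
move=> x y z; rewrite /aff_mul /= addrA; congr pair.
by rewrite expfzDr ?pnatr_eq0 // mulrDr mulrA addrA.
Qed.

Lemma aff_mul1 x : aff_mul (0, 0) x = x.
Proof. by case: x => x k; rewrite /aff_mul /= !add0r expr0z mul1r. Qed.

Lemma aff_word_cat w1 w2 :
  aff_word (w1 ++ w2) = aff_mul (aff_word w1) (aff_word w2).
Proof.
by elim: w1 => [|l w1 ih] /=; rewrite ?aff_mul1 // ih aff_mulA.
Qed.

Lemma aff_word_eq w1 w2 :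
  word_eq [set BS12_relator] w1 w2 -> aff_word w1 = aff_word w2.
Proof.
elim=> // {w1 w2}.
- by move=> w1 w2 w3 _ -> _ ->.
- by move=> w1 w2 w3 w4 _ e1 _ e2; rewrite !aff_word_cat e1 e2.
- move=> x b; rewrite /= /aff_mul /aff_letter.
  by case: x; case: b => /=; rewrite ?expr0z !(mul1r, mulr0, addr0) ?subrr ?addNr.
- move=> r ->; rewrite /= /aff_mul /aff_letter /= expr0z expr1z; congr pair.
  by rewrite -[2^(-1)]/(2^-1); field.
Qed.

Definition aff (g : BS12) : R * int :=
  aff_word (repr (g : {eq_quot (word_equiv [set BS12_relator])})).

Definition pos (g : BS12) : R := (aff g).1.
Definition lev (g : BS12) : int := (aff g).2.

Lemma aff_class w : aff (pres_class _ w) = aff_word w.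
Proof. exact/aff_word_eq/word_eq_repr. Qed.

Lemma affM g h : aff (g * h)%g = aff_mul (aff g) (aff h).
Proof.
rewrite -[g]pres_classE -[h]pres_classE.
rewrite [X in aff X](pres_mulE [set BS12_relator]).
by rewrite !aff_class aff_word_cat.
Qed.

Lemma posM g h : pos (g * h)%g = pos g + 2 ^ lev g * pos h.
Proof. by rewrite /pos affM. Qed.
Lemma levM g h : lev (g * h)%g = lev g + lev h.
Proof. by rewrite /lev affM. Qed.
Lemma aff1 : aff 1%g = (0, 0).
Proof. exact: (aff_class [::]). Qed.
Lemma pos1 : pos 1%g = 0. Proof. by rewrite /pos aff1. Qed.
Lemma lev1 : lev 1%g = 0. Proof. by rewrite /lev aff1. Qed.
Lemma levV g : lev g^-1%g = - lev g.
Proof. by apply/eqP; rewrite -addr_eq0 -levM mulVg lev1. Qed.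
Lemma posV g : pos g^-1%g = - (2 ^ (- lev g) * pos g).
Proof.
by apply/eqP; rewrite -addr_eq0 -levV -posM mulVg pos1.
Qed.
Lemma lev_a : lev gen_a = 0.
Proof. by rewrite /lev /gen_a aff_class. Qed.
Lemma pos_a : pos gen_a = 1.
Proof. by rewrite /pos /gen_a aff_class /= mulr0 addr0. Qed.
Lemma lev_t : lev gen_t = 1.
Proof. by rewrite /lev /gen_t aff_class. Qed.
Lemma pos_t : pos gen_t = 0.
Proof. by rewrite /pos /gen_t aff_class /= mulr0 addr0. Qed.

Lemma levX g n : lev (g ^+ n)%g = lev g * n%:Z.
Proof.
elim: n => [|n ih]; first by rewrite expg0 lev1 mulr0.
by rewrite expgS levM ih; lia.
Qed.
Lemma pos_aX n : pos (gen_a ^+ n)%g = n%:R.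
Proof.
elim: n => [|n ih]; first by rewrite expg0 pos1.
by rewrite expgS posM ih lev_a pos_a expr0z mul1r -natr1 addrC.
Qed.
Lemma pos_tX n : pos (gen_t ^+ n)%g = 0.
Proof.
elim: n => [|n ih]; first by rewrite expg0 pos1.
by rewrite expgS posM ih pos_t mulr0 addr0.
Qed.

Definition affE := (posM, levM, posV, levV, levX, pos_aX, pos_tX,
  lev_a, pos_a, lev_t, pos_t, pos1, lev1).

End Affine.

Lemma t_aX n : (gen_t * gen_a ^+ n = gen_a ^+ (2 * n) * gen_t)%g.
Proof.
elim: n => [|n ih]; first by rewrite !expg0 mulg1 mul1g.
have -> : (2 * n.+1 = 2 * n + 2)%N by lia.
by rewrite expgSr mulgA ih -mulgA BS12_relation (expgnDr _ (2 * n)) expg2 !mulgA.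
Qed.

Lemma tX_a n : (gen_t ^+ n * gen_a = gen_a ^+ (2 ^ n) * gen_t ^+ n)%g.
Proof.
elim: n => [|n ih]; first by rewrite !expg0 mulg1 mul1g.
by rewrite expgS -mulgA ih mulgA t_aX -mulgA -expnS.
Qed.

(** The powers of t can be pushed to the outside because conjugation by t
    doubles powers of a.  The exponent of a is split as i - j to stay in [nat]. *)
Lemma BS12_normal_form (g : BS12) : exists p i j r : nat,
  g = (gen_t ^- p * (gen_a ^+ i * gen_a ^- j) * gen_t ^+ r)%g.
Proof.
elim/BS12_ind: g => [|_ [p [i [j [r ->]]]]].
  by exists 0, 0, 0, 0; rewrite !expg0 invg1 !mulg1.
have at_ : (gen_a * gen_t ^- p = gen_t ^- p * gen_a ^+ (2 ^ p))%g.
  by apply: (mulgI (gen_t ^+ p)%g); rewrite mulVKg mulgA tX_a mulgK.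
have c (x y : nat) : (gen_a ^- x * gen_a ^+ y = gen_a ^+ y * gen_a ^- x)%g.
  by apply: commute_sym; apply: commuteV; apply: commuteX2.
have Vt : (gen_a^-1 * gen_t ^- p = gen_t ^- p * gen_a ^- (2 ^ p))%g.
  by apply: (mulgI gen_a); rewrite mulVKg mulgA at_ mulgK.
split.
- exists p, (2 ^ p + i)%N, j, r.
  by rewrite !mulgA at_ expgnDr !mulgA.
- exists p, i, (2 ^ p + j)%N, r.
  rewrite addnC expgnDr invgM !mulgA Vt; congr (_ * _)%g.
  by rewrite -!mulgA; congr (_ * _)%g; rewrite !mulgA c.
- case: p {at_ Vt} => [|p].
    exists 0, (2 * i)%N, (2 * j)%N, r.+1.
    rewrite !expg0 !invg1 !mul1g !mulgA t_aX expgS !mulgA.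
    congr (_ * _)%g; rewrite -!mulgA; congr (_ * _)%g.
    apply: (mulIg (gen_a ^+ j)%g); rewrite mulgVK -mulgA t_aX.
    by rewrite mulKg.
  exists p, i, j, r; rewrite !mulgA; congr (_ * _ * _ * _)%g.
  by rewrite expgSr invgM mulVKg.
- exists p.+1, i, j, r; rewrite !mulgA; congr (_ * _ * _ * _)%g.
  by rewrite expgSr invgM.
Qed.

(** A normal form t^-p a^(i-j) t^r is sent to (2^-p (i - j), r - p), which
    vanishes only if i = j and r = p.  This is what turns identities between
    words into computations with two numbers. *)
Lemma aff_inj (R : realType) : injective (aff R).
Proof.
suff h g : aff R g = (0, 0) -> g = 1%g.
  move=> g h' e; apply/divg1_eq/h.
  have := affM R (g / h') h'; rewrite mulgVK e.
  case: (aff R (g / h')) (aff R h') => x k [y m]; rewrite /aff_mul /= => -[].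
  move=> e1 e2; have k0 : k = 0 by move: e2; lia.
  move: e1; rewrite k0 expr0z mul1r => e1; congr pair.
  by move/eqP: e1; rewrite -subr_eq subrr => /eqP.
have [p [i [j [r ->]]]] := BS12_normal_form g.
move=> e; have eq1 : pos R (gen_t ^- p * (gen_a ^+ i * gen_a ^- j) * gen_t ^+ r)%g = 0.
  by rewrite /pos e.
have eq2 : lev R (gen_t ^- p * (gen_a ^+ i * gen_a ^- j) * gen_t ^+ r)%g = 0.
  by rewrite /lev e.
move: eq1 eq2; rewrite !affE !(mul0r, oppr0, expr0z, mul1r, mulr0, addr0).
rewrite add0r => /eqP; rewrite mulf_eq0 expfz_eq0 pnatr_eq0 andbF /= subr_eq0.
rewrite eqr_nat => /eqP -> e2; have -> : r = p by move: e2; lia.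
by rewrite mulgV mulg1 mulVg.
Qed.

Lemma BS12_ext (R : realType) g h :
  pos R g = pos R h -> lev R g = lev R h -> g = h.
Proof.
move=> e1 e2; apply: (@aff_inj R).
by rewrite [LHS]surjective_pairing [RHS]surjective_pairing; congr pair.
Qed.

Lemma generates_gen (S : seq BS12) :
  (forall H : {pred BS12}, group_closed H -> {subset S <= H} ->
     gen_a \in H /\ gen_t \in H) -> generates S.
Proof.
move=> hS H Hg SH; have [aH tH] := hS H Hg SH.
have [H1 HF] := Hg.
have HV := group_closedV Hg; have HM := group_closedM Hg.
elim/BS12_ind => [//|g gH]; split; apply: HM => //; exact: HV.
Qed.

(** * Combinatorial and length metrics *)

Section Reach.
Variable Gam : simple_graph.
Implicit Types u v w : Gam.

(** A relation rather than a distance function: it is monotone in n and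
    composes by concatenation, which is all that the estimates below need. *)
Definition reach (n : nat) u v : Prop :=
  exists s, [/\ path (@adj Gam) u s, last u s = v & (size s <= n)%N].

Lemma reach_refl n u : reach n u u.
Proof. by exists [::]. Qed.

Lemma reach_mono m n u v : (m <= n)%N -> reach m u v -> reach n u v.
Proof. by move=> mn [s [ps ls sm]]; exists s; split=> //; lia. Qed.

Lemma reach_trans m n u v w : reach m u v -> reach n v w -> reach (m + n) u w.
Proof.
move=> [s [ps ls sm]] [s' [ps' ls' sn]]; exists (s ++ s').
by rewrite cat_path ps last_cat ls size_cat; split=> //; lia.
Qed.

Lemma reach1 u v : adj u v -> reach 1 u v.
Proof. by exists [:: v]; rewrite /= andbT. Qed.

Lemma path_rev u s : path (@adj Gam) u s ->
  path (@adj Gam) (last u s) (rev (belast u s)).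
Proof.
move=> ps; rewrite rev_path; apply: sub_path ps => x y.
by rewrite adj_sym.
Qed.

Lemma last_rev_belast u s : last (last u s) (rev (belast u s)) = u.
Proof. by case: s => //= x s; rewrite rev_cons last_rcons. Qed.

Lemma reach_sym n u v : reach n u v -> reach n v u.
Proof.
move=> [s [ps <- sn]]; exists (rev (belast u s)); split.
- exact: path_rev.
- exact: last_rev_belast.
- by rewrite size_rev size_belast.
Qed.

Lemma reach0 u v : reach 0 u v -> u = v.
Proof. by move=> [[|x s] []]. Qed.

Lemma reach1_inv u v : reach 1 u v -> u = v \/ adj u v.
Proof.
by move=> [[|x [|y s]] [//= + <-]]; [left|rewrite andbT; right].
Qed.

Lemma reach_S n u v : reach n.+1 u v -> reach n u v \/
  exists2 w, adj u w & reach n w v.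
Proof.
move=> [[|w s] [/= ps ls sn]]; first by left; exists [::].
by right; move/andP: ps => [uw ps]; exists w => //; exists s.
Qed.

Lemma connected_reach u v : connected_graph Gam -> exists n, reach n u v.
Proof. by move=> [_ /(_ u v)[s ps ls]]; exists (size s), s. Qed.

End Reach.

Section Metric.
Variables (R : realType) (Gam : simple_graph).
Implicit Types (u v w : Gam) (x y z : realization R Gam).
Local Notation vp := (@vertex_point R Gam).

Lemma segment_ge0 x y (l : R) : segment_path x y l -> 0 <= l.
Proof. by elim=> // *; exact: addr_ge0. Qed.

Lemma gdist_le x y (l : R) : segment_path x y l -> gdist x y <= l.
Proof. by move=> h; apply: ge_inf => //; exists 0 => ? /segment_ge0. Qed.

Lemma le_gdist x y (l e : R) : segment_path x y l ->
  (forall l', segment_path x y l' -> e <= l') -> e <= gdist x y.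
Proof. by move=> xy h; apply: lb_le_inf; [exists l|move=> ? /h]. Qed.

Lemma gdist_lt x y (l e : R) : segment_path x y l -> gdist x y < e ->
  exists2 l', segment_path x y l' & l' < e.
Proof. by move=> xy /inf_lt; apply; exists l. Qed.

Lemma adj_neq u v : adj u v -> u != v.
Proof. by apply: contraTneq => ->; rewrite adj_irr. Qed.

Lemma coord_ge0 x w : 0 <= x w.
Proof.
have [a [b [s [_ /andP[s0 s1] ->]]]] := coordP x.
by rewrite addr_ge0 ?mulr_ge0 ?subr_ge0.
Qed.

Lemma closed_edge_sum u v x : u != v -> closed_edge u v x -> x u + x v = 1.
Proof.
move=> uv ex; have [a [b [s [ab /andP[s0 s1] xE]]]] := coordP x.
have one c : c = u \/ c = v -> (u == c)%:R + (v == c)%:R = 1 :> R.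
  by move=> [->|->]; rewrite eqxx ?[v == u]eq_sym (negbTE uv) ?addr0 ?add0r.
have h (r : R) c : 0 <= r -> r <= x c -> r * ((u == c)%:R + (v == c)%:R) = r.
  move=> r0 rx; have [->|rn0] := eqVneq r 0; first by rewrite mul0r.
  rewrite one ?mulr1 //; apply: ex; apply: lt0r_neq0.
  by apply: lt_le_trans rx; rewrite lt0r rn0.
have ha := h s a s0; have hb := h (1 - s) b.
rewrite !xE addrACA -!mulrDr ha ?hb ?subr_ge0 //; first by ring.
- by rewrite xE eqxx mulr1 lerDr mulr_ge0.
- by rewrite xE eqxx mulr1 lerDl mulr_ge0 // subr_ge0.
Qed.

Lemma closed_edge_eq0 u v x w : closed_edge u v x -> w != u -> w != v -> x w = 0.
Proof.
move=> ex /eqP wu /eqP wv; apply: contrapT => /eqP /ex [] //.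
Qed.

Lemma closed_edgeC u v x : closed_edge u v x -> closed_edge v u x.
Proof. by move=> ex w /ex [->|->]; [right|left]. Qed.

Lemma closed_edge_inj u v x y : u != v -> closed_edge u v x ->
  closed_edge u v y -> x u = y u -> x = y.
Proof.
move=> uv ex ey xy; apply: realization_eq => w.
have [->//|wu] := eqVneq w u.
have [->|wv] := eqVneq w v; last by rewrite !(closed_edge_eq0 _ wu wv).
have := closed_edge_sum uv ex; have := closed_edge_sum uv ey.
by rewrite xy => <- /addrI.
Qed.

Lemma closed_edge_dist u v x y w : u != v -> closed_edge u v x ->
  closed_edge u v y -> w = u \/ w = v -> `|x w - y w| = `|x u - y u|.
Proof.
move=> uv ex ey [->//|->].
have hx := closed_edge_sum uv ex; have hy := closed_edge_sum uv ey.
by rewrite -normrN; congr `|_|; lra.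
Qed.

(** Barycentric coordinates separate vertices at a definite scale, which gives
    the finiteness results for compact sets below. *)
Lemma coord_lipschitz x y (l : R) w : segment_path x y l -> `|x w - y w| <= l.
Proof.
elim=> [|y' z l' u v _ ih uv ey ez]; first by rewrite subrr normr0.
have -> : x w - z w = (x w - y' w) + (y' w - z w) by ring.
apply: le_trans (ler_normD _ _) _; apply: lerD => //.
have [->//|wu] := eqVneq w u.
have [->|wv] := eqVneq w v.
  by rewrite (closed_edge_dist (adj_neq uv) ey ez) //; right.
by rewrite (closed_edge_eq0 ey wu wv) (closed_edge_eq0 ez wu wv) subrr normr0.
Qed.

Lemma vpE v w : vp v w = (w == v)%:R.
Proof. by []. Qed.

Lemma vp_inj : injective vp.
Proof.
move=> u v /(congr1 (fun x : realization R Gam => x u)); rewrite !vpE eqxx.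
by have [//|_ /eqP] := eqVneq u v; rewrite oner_eq0.
Qed.

Lemma vp_edgel u v : closed_edge u v (vp u).
Proof. by move=> w; rewrite vpE; case: (eqVneq w u) => [->|_]; [left|rewrite eqxx]. Qed.

Lemma vp_edge u v w : w = u \/ w = v -> closed_edge u v (vp w).
Proof. by move=> [->|->]; [|apply: closed_edgeC]; exact: vp_edgel. Qed.

Lemma vp_edge_inv u v w : closed_edge u v (vp w) -> w = u \/ w = v.
Proof. by move/(_ w); rewrite vpE eqxx oner_neq0; apply. Qed.

Lemma segment_walk u s : path (@adj Gam) u s ->
  segment_path (vp u) (vp (last u s)) (size s)%:R.
Proof.
elim/last_ind: s => [|s v ih]; first by move=> _; exact: SegmentNil.
rewrite rcons_path => /andP[ps adjv]; rewrite last_rcons size_rcons -natr1.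
have e : 1 = `|vp (last u s) (last u s) - vp v (last u s)| :> R.
  by rewrite !vpE eqxx (negbTE (adj_neq adjv)) subr0 normr1.
by rewrite [X in _ + X]e; apply: (SegmentRcons (ih ps) adjv);
  [exact: vp_edgel|apply: vp_edge; right].
Qed.

(** As long as a path stays in the edge where it starts, its length controls one
    coordinate.  It can leave this edge only through an end point a, at cost
    [1 - x a]; from then on a walk from a to a vertex b of the edge containing
    the current point y is updated at each step, b changing only when y reaches
    the other end of that edge. *)
Lemma segment_path_walk x y (l : R) u0 v0 :
  segment_path x y l -> adj u0 v0 -> closed_edge u0 v0 x ->
  (closed_edge u0 v0 y /\ `|x u0 - y u0| <= l) \/
  exists a b n, [/\ a = u0 \/ a = v0, reach n a b, y b != 0 &
    (1 - x a) + n%:R + (1 - y b) <= l].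
Proof.
move=> xy uv0 ex; elim: xy => [|y' z l' u v _ ih uv ey ez].
  by left; rewrite subrr normr0.
have nuv := adj_neq uv; have nuv0 := adj_neq uv0.
pose good (b : Gam) := exists a n, [/\ a = u0 \/ a = v0, reach n a b &
    (1 - x a) + n%:R + (1 - y' b) <= l'].
have step b : y' b != 0 -> good b -> exists a b n,
    [/\ a = u0 \/ a = v0, reach n a b, z b != 0 &
    (1 - x a) + n%:R + (1 - z b) <= l' + `|y' u - z u|].
  move=> yb0 [a [n [a0 rn le]]]; have buv := ey _ yb0.
  have d : `|y' b - z b| = `|y' u - z u|.
    by rewrite (closed_edge_dist nuv ey ez).
  have [zb0|zb0] := eqVneq (z b) 0; last first.
    exists a, b, n; split=> //; rewrite -d.
    by have := ler_norm (y' b - z b); lra.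
  pose c := if b == u then v else u.
  have bc : adj b c /\ z b + z c = 1.
    rewrite /c; have [->|nbu] := eqVneq b u.
      by split=> //; exact: closed_edge_sum.
    case: buv nbu => [->|->]; first by rewrite eqxx.
    by rewrite adj_sym addrC; split=> //; exact: closed_edge_sum.
  have [adjbc sumbc] := bc; rewrite zb0 add0r in sumbc.
  exists a, c, n.+1; split=> //.
  - by rewrite -addn1; apply: reach_trans rn _; exact: reach1.
  - by rewrite sumbc oner_neq0.
  - rewrite -natr1 sumbc -d zb0 subr0.
    by have := ler_norm (y' b); lra.
case: ih => [[ey0 le]|[a [b [n [a0 rn yb0 le]]]]]; last first.
  by right; apply: (step b) => //; exists a, n.
have [same|diff] := pselect (closed_edge u0 v0 z).
  left; split=> //.
  have -> : x u0 - z u0 = (x u0 - y' u0) + (y' u0 - z u0) by ring.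
  apply: le_trans (ler_normD _ _) _; apply: lerD => //.
  have [e|nu] := eqVneq u0 u; first by rewrite e.
  have [e|nv] := eqVneq u0 v.
    by rewrite (closed_edge_dist nuv ey ez) //; right.
  by rewrite (closed_edge_eq0 ey nu nv) (closed_edge_eq0 ez nu nv) subrr normr0.
right.
(* A point on two different edges is a vertex. *)
have [b yb1] : exists b, y' b = 1.
  apply: contrapT => /forallNP no; apply: diff.
  have n1 := closed_edge_sum nuv ey; have n2 := closed_edge_sum nuv0 ey0.
  have yu0 : y' u != 0.
    by apply/eqP => e; apply: (no v); move: n1; rewrite e add0r.
  have yv0 : y' v != 0.
    by apply/eqP => e; apply: (no u); move: n1; rewrite e addr0.
  by move=> w /ez [->|->]; exact: ey0.
have yb0 : y' b != 0 by rewrite yb1 oner_neq0.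
apply: (step b) => //; exists b, 0%N.
have b0 := ey0 _ yb0; split=> //; first exact: reach_refl.
rewrite addr0 yb1 subrr addr0; apply: le_trans le.
rewrite -(closed_edge_dist nuv0 ex ey0 b0) yb1 distrC.
exact: ler_norm.
Qed.

(** The combinatorial metric is the restriction of the length metric to the
    vertices; the other inequality is [reach_segment]. *)
Lemma segment_reach u v (l : R) : connected_graph Gam ->
  segment_path (vp u) (vp v) l -> exists2 n, n%:R <= l & reach n u v.
Proof.
move=> [_ conG] h; have [->|nuv] := eqVneq u v.
  by exists 0%N; [exact: segment_ge0 h|exact: reach_refl].
have [w uw] : exists w, adj u w.
  have [[|w s] /=] := conG u v; last by move=> /andP[? _] _; exists w.
  by move=> _ e; rewrite e eqxx in nuv.
have l1 : 1 <= l.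
  by have := coord_lipschitz u h; rewrite !vpE eqxx (negbTE nuv) subr0 normr1.
have ruw := reach1 uw.
case: (segment_path_walk h uw (@vp_edgel u w)) => [[vuw _]|].
  case: (vp_edge_inv vuw) => [e|->]; first by rewrite e eqxx in nuv.
  by exists 1%N.
move=> [a [b [n [a0 rn vb0 le]]]].
have bv : b = v by move: vb0; rewrite vpE; have [//|_ /eqP] := eqVneq b v.
move: rn vb0 le; rewrite {b}bv => rn _; rewrite !vpE eqxx subrr addr0.
case: a0 rn => -> rn; first by rewrite eqxx subrr add0r => le; exists n.
rewrite eq_sym (negbTE (adj_neq uw)) subr0 => le; exists n.+1.
  by rewrite -natr1 addrC.
by rewrite -add1n; exact: reach_trans ruw rn.
Qed.

Lemma reach_segment n u v : reach n u v ->
  exists2 l : R, segment_path (vp u) (vp v) l & l <= n%:R.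
Proof.
move=> [s [ps <- sn]]; exists (size s)%:R; first exact: segment_walk.
by rewrite ler_nat.
Qed.

Lemma circle_dist_le (n : nat) (x y : R) (k : int) :
  circle_dist n x y <= `|x - y + k%:~R * n%:R|.
Proof. by apply: ge_inf; [exists 0 => _ [j _ <-]|exists k]. Qed.

End Metric.

(** * Cycles traced by closed walks *)

Section Periodize.
Variables (T : Type) (n : nat) (q : nat -> T).
Hypothesis n0 : (0 < n)%N.
Hypothesis qn : q n = q 0%N.

(** A finite closed walk, seen as a walk on the integers modulo its length. *)
Definition periodize (i : int) : T := q `|(i %% n%:Z)%Z|%N.

Lemma periodizeE (j : nat) (k : int) : (j <= n)%N ->
  periodize (j%:Z + k * n%:Z) = q j.
Proof.
rewrite /periodize leq_eqVlt => /orP[/eqP ->|jn].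
  have -> : n%:Z + k * n%:Z = 0 + (k + 1) * n%:Z by ring.
  by rewrite addrC modzMDl mod0z qn.
by rewrite addrC modzMDl modz_small //; lia.
Qed.

Lemma periodize_ind (i : int) : exists2 j : nat, (j < n)%N &
  exists k : int, i = j%:Z + k * n%:Z.
Proof.
have m0 : 0 <= (i %% n%:Z)%Z by rewrite modz_ge0; lia.
have mn : (i %% n%:Z)%Z < n%:Z by apply: ltz_pmod.
exists `|(i %% n%:Z)%Z|%N; first by lia.
by exists (i %/ n%:Z)%Z; rewrite gez0_abs // addrC -divz_eq.
Qed.

Lemma periodize_period i : periodize (i + n%:Z) = periodize i.
Proof.
have [j jn [k ->]] := periodize_ind i.
have -> : j%:Z + k * n%:Z + n%:Z = j%:Z + (k + 1) * n%:Z by ring.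
by rewrite !periodizeE // ltnW.
Qed.

Lemma periodize_rel (e : T -> T -> Prop) :
  (forall j, (j < n)%N -> e (q j) (q j.+1)) ->
  forall i, e (periodize i) (periodize (i + 1)).
Proof.
move=> qe i; have [j jn [k ->]] := periodize_ind i.
rewrite addrAC -[j%:Z + 1]/((j + 1)%N%:Z) !periodizeE //; try lia.
by rewrite addn1; exact: qe.
Qed.

End Periodize.

Section CycleMap.
Variables (R : realType) (Gam : simple_graph) (c : int -> Gam).
Hypothesis adjc : forall i, adj (c i) (c (i + 1)).
Local Notation vp := (@vertex_point R Gam).

Lemma floorP (x : R) : (Num.floor x)%:~R <= x < (Num.floor x)%:~R + 1.
Proof. by have := floor_itv x; rewrite intrD. Qed.

Lemma cycle_map_subproof (x : R) : is_point (fun w : Gam =>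
  (1 - (x - (Num.floor x)%:~R)) * (w == c (Num.floor x))%:R
  + (x - (Num.floor x)%:~R) * (w == c (Num.floor x + 1))%:R).
Proof.
have /andP[x0 x1] := floorP x.
exists (c (Num.floor x)), (c (Num.floor x + 1)),
  (1 - (x - (Num.floor x)%:~R)).
split; [by right|by apply/andP; split; lra|by move=> w; congr (_ + _ * _); ring].
Qed.

Definition cycle_map (x : R) : realization R Gam := Point (cycle_map_subproof x).
Local Notation F := cycle_map.

Lemma cycle_mapE (i : int) (x : R) w : i%:~R <= x <= i%:~R + 1 ->
  F x w = (1 - (x - i%:~R)) * (w == c i)%:R + (x - i%:~R) * (w == c (i + 1))%:R.
Proof.
move=> /andP[ix]; rewrite le_eqVlt => /orP[/eqP ->|xi].
  have fl : Num.floor (i%:~R + 1 : R) = i + 1.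
    by rewrite -[1]/(1%:~R) -intrD intrKfloor.
  by rewrite /= fl intrD; ring.
have fl : Num.floor x = i by apply: floor_def; rewrite ix intrD xi.
by rewrite /= fl.
Qed.

Lemma cycle_map_int (i : int) : F i%:~R = vp (c i).
Proof.
apply: realization_eq => w; rewrite (@cycle_mapE i) ?lexx ?lerDl ?ler01 //.
by rewrite subrr subr0 mul1r mul0r addr0.
Qed.

Lemma cycle_map_edge (i : int) (x : R) : i%:~R <= x <= i%:~R + 1 ->
  closed_edge (c i) (c (i + 1)) (F x).
Proof.
move=> ix w; rewrite (cycle_mapE _ ix).
have [->|wi] := eqVneq w (c i); first by left.
have [->|wi'] := eqVneq w (c (i + 1)); first by right.
by rewrite !mulr0 addr0 eqxx.
Qed.

Lemma cycle_map_coord (i : int) (x : R) : i%:~R <= x <= i%:~R + 1 ->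
  F x (c i) = 1 - (x - i%:~R) /\ F x (c (i + 1)) = x - i%:~R.
Proof.
move=> ix; rewrite !(cycle_mapE _ ix) !eqxx [c (i + 1) == c i]eq_sym.
by rewrite (negbTE (adj_neq (adjc i))) !mulr1 !mulr0 addr0 add0r.
Qed.

(** The map is piecewise isometric, hence 1-Lipschitz; it need not be locally
    injective since [c] may backtrack. *)
Lemma cycle_map_segment (x y : R) : segment_path (F x) (F y) `|x - y|.
Proof.
have same i z t : i%:~R <= z <= i%:~R + 1 -> i%:~R <= t <= i%:~R + 1 ->
    segment_path (F z) (F t) `|z - t|.
  move=> iz it; have := SegmentRcons (SegmentNil (F z)) (adjc i)
    (cycle_map_edge iz) (cycle_map_edge it).
  rewrite add0r (cycle_map_coord iz).1 (cycle_map_coord it).1.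
  by rewrite distrC; congr (segment_path _ _ `|_|); ring.
wlog xy : x y / x <= y.
  move=> h; have [/h//|/ltW/h] := leP x y.
  by rewrite distrC; exact: segment_path_sym.
have [n En] : exists n : nat, Num.floor y = Num.floor x + n%:Z.
  exists `|(Num.floor y - Num.floor x)%R|%N.
  by rewrite gez0_abs ?subr_ge0 ?le_floor // addrC subrK.
elim: n x xy En => [|n ih] x xy En.
  have /andP[x0 x1] := floorP x; have /andP[y0 y1] := floorP y.
  rewrite En addr0 in y0 y1.
  by apply: (same (Num.floor x)); apply/andP; split=> //; exact: ltW.
have /andP[x0 x1] := floorP x.
pose z : R := (Num.floor x + 1)%:~R.
have Ez : z = (Num.floor x)%:~R + 1 by rewrite /z intrD.
have fz : Num.floor z = Num.floor x + 1 by exact: intrKfloor.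
have zy : z <= y by rewrite /z -floor_ge_int En; lia.
have xz : x <= z by rewrite Ez ltW.
have := ih z zy; rewrite fz => /(_ _) hz.
have -> : `|x - y| = `|x - z| + `|z - y|.
  by rewrite !ler0_norm ?subr_le0 //; ring.
apply: segment_path_cat (hz _); last by rewrite En; lia.
by apply: (same (Num.floor x)); apply/andP; split; rewrite ?Ez ?lerDl // ltW.
Qed.

Lemma cycle_map_continuous : continuous cycle_map.
Proof.
move=> x; apply/cvg_ballP => e e0; near=> y.
exists `|x - y|; first exact: cycle_map_segment.
by near: y; exact: cvgr_dist_lt.
Unshelve. all: by end_near. Qed.

Lemma cycle_map_onto (i : int) :
  F @` [set` `[i%:~R : R, (i + 1)%:~R]] = closed_edge (c i) (c (i + 1)).
Proof.
rewrite intrD; apply/seteqP; split => [_ [x /= ix <-]|y ey].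
  by apply: cycle_map_edge; move: ix; rewrite in_itv.
have nc := adj_neq (adjc i); have sum := closed_edge_sum nc ey.
have y0 := coord_ge0 y (c i); have y1 := coord_ge0 y (c (i + 1)).
have ix : i%:~R <= i%:~R + y (c (i + 1)) <= i%:~R + 1 by apply/andP; split; lra.
exists (i%:~R + y (c (i + 1))); first by rewrite /= in_itv.
apply: (closed_edge_inj nc (cycle_map_edge ix) ey).
by rewrite (cycle_map_coord ix).1; lra.
Qed.

Lemma cycle_map_period (n : nat) : (forall i, c (i + n%:Z) = c i) ->
  forall x, F (x + n%:R) = F x.
Proof.
move=> cn x; apply: realization_eq => w; have /andP[x0 x1] := floorP x.
rewrite (@cycle_mapE (Num.floor x + n%:Z)); last first.
  by rewrite intrD -pmulrn; apply/andP; split; lra.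
rewrite (@cycle_mapE (Num.floor x)) ?x0 1?ltW //.
by rewrite [_ + n%:Z + 1]addrAC !cn intrD -pmulrn; congr (_ * _ + _ * _); ring.
Qed.

Lemma cycle_map_periodz (n : nat) : (forall i, c (i + n%:Z) = c i) ->
  forall x (k : int), F (x + k%:~R * n%:R) = F x.
Proof.
move=> cn x k; have P y (m : nat) : F (y + m%:R * n%:R) = F y.
  elim: m y => [|m ih] y; first by rewrite mul0r addr0.
  by rewrite -natr1 mulrDl mul1r addrA cycle_map_period.
case: k => m; first by rewrite -pmulrn P.
by rewrite -[LHS](P _ m.+1); congr F; rewrite NegzE mulrNz -pmulrn; ring.
Qed.

Lemma cycle_mapP (n : nat) : (0 < n)%N -> (forall i, c (i + n%:Z) = c i) ->
  is_cycle n cycle_map.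
Proof.
move=> n0 cn; split=> //.
- exact: cycle_map_period.
- exact: cycle_map_continuous.
- by move=> i; exists (c i) => //; rewrite cycle_map_int.
- by move=> i; exists (c i), (c (i + 1)); split=> //; exact: cycle_map_onto.
Qed.

(** Between antipodal points in the interior of two opposite edges there are
    four ways to choose the end points through which a path leaves and enters;
    these are at distance at least m, or m - 1, and in the latter case the two
    pieces of edge add up to 1. *)
Lemma cycle_map_antipodal (m : nat) : (1 < m)%N ->
  (forall i k, reach k (c i) (c (i + m%:Z)) -> (m <= k)%N) ->
  forall x l, segment_path (F x) (F (x + m%:R)) l -> m%:R <= l.
Proof.
move=> m1 far x l h; set i := Num.floor x; have /andP[x0 x1] := floorP x.
have ix : i%:~R <= x <= i%:~R + 1 by rewrite x0 ltW.
have ixm : (i + m%:Z)%:~R <= x + m%:R <= (i + m%:Z)%:~R + 1.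
  by rewrite intrD -pmulrn; apply/andP; split; lra.
have [p0 p1] := cycle_map_coord ix; have [q0 q1] := cycle_map_coord ixm.
have eqm : (i + m%:Z)%:~R = i%:~R + m%:R :> R by rewrite intrD -pmulrn.
rewrite eqm in q0 q1.
have far1 k : reach k (c (i + 1)) (c (i + m%:Z)) -> (m <= k.+1)%N.
  move=> r; apply: (far i); rewrite -add1n.
  by apply: reach_trans r; exact: reach1.
have far2 k : reach k (c i) (c (i + m%:Z + 1)) -> (m <= k.+1)%N.
  move=> r; apply: (far i); rewrite -addn1.
  by apply: reach_trans r _; apply: reach1; rewrite adj_sym.
have far3 k : reach k (c (i + 1)) (c (i + m%:Z + 1)) -> (m <= k)%N.
  by rewrite addrAC; exact: far.
have nat_le (a b : nat) : (a <= b)%N -> a%:R <= b%:R :> R by rewrite ler_nat.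
case: (segment_path_walk h (adjc i) (cycle_map_edge ix)) => [[same _]|].
  have /same[e|e] : F (x + m%:R) (c (i + m%:Z)) != 0.
    by apply: lt0r_neq0; rewrite q0; lra.
  - by have := @far i 0%N; rewrite e => /(_ (reach_refl _ _)); lia.
  - by have := @far1 0%N; rewrite e => /(_ (reach_refl _ _)); lia.
move=> [a [b [k [a0 rk yb0]]]].
have b0 := cycle_map_edge ixm yb0.
case: a0 rk => ->; case: b0 => -> rk; rewrite ?p0 ?p1 ?q0 ?q1.
- by have := nat_le _ _ (far _ _ rk); lra.
- by have := nat_le _ _ (far2 _ rk); rewrite -natr1; lra.
- by have := nat_le _ _ (far1 _ rk); rewrite -natr1; lra.
- by have := nat_le _ _ (far3 _ rk); lra.
Qed.

(** Antipodal points suffice: a shortcut between x and y extends, along the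
    cycle, to a shortcut between x and the antipode of x. *)
Lemma cycle_map_isometric (m : nat) : (1 < m)%N ->
  (forall i, c (i + (2 * m)%:Z) = c i) ->
  (forall i k, reach k (c i) (c (i + m%:Z)) -> (m <= k)%N) ->
  isometric_cycle (2 * m) cycle_map.
Proof.
move=> m1 cn far; split; first by apply: cycle_mapP => //; lia.
move=> x y; have n0 : 0 < (2 * m)%:R :> R by rewrite ltr0n; lia.
have En : (2 * m)%:R = m%:R + m%:R :> R by rewrite mul2n -addnn natrD.
apply/eqP; rewrite eq_le; apply/andP; split.
  apply: lb_le_inf; first by eexists; exists 0.
  move=> _ [k _ <-]; apply: gdist_le.
  rewrite -[F y](cycle_map_periodz cn _ (- k)).
  have := cycle_map_segment x (y + (- k)%:~R * (2 * m)%:R).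
  by congr (segment_path _ _ `|_|); rewrite mulrNz; ring.
apply: (le_gdist (cycle_map_segment x y)) => l xyl.
(* The point y is at position z, in [0, 2m), on the circle seen from x. *)
pose k := Num.floor ((y - x) / (2 * m)%:R).
have /andP[k0 k1] := floorP ((y - x) / (2 * m)%:R).
rewrite -/k in k0 k1; rewrite ler_pdivlMr // in k0.
rewrite ltr_pdivrMr // mulrDl mul1r in k1.
pose z := y - x - k%:~R * (2 * m)%:R.
have anti := cycle_map_antipodal m1 far.
have Fy : F (x + z) = F y.
  rewrite -[RHS](cycle_map_periodz cn _ (- k)); congr F.
  by rewrite /z mulrNz; ring.
have [zm|zm] := leP z m%:R.
  apply: le_trans (circle_dist_le (2 * m) x y k) _.
  have -> : x - y + k%:~R * (2 * m)%:R = - z by rewrite /z; ring.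
  rewrite normrN ger0_norm; last by rewrite /z; lra.
  rewrite -Fy in xyl.
  have := anti x _ (segment_path_cat xyl (cycle_map_segment (x + z) (x + m%:R))).
  by rewrite ler0_norm; lra.
apply: le_trans (circle_dist_le (2 * m) x y (k + 1)) _.
have -> : x - y + (k + 1)%:~R * (2 * m)%:R = (2 * m)%:R - z.
  by rewrite /z intrD; ring.
rewrite ger0_norm; last by rewrite /z; lra.
rewrite -Fy in xyl.
have := anti x _ (segment_path_cat xyl (cycle_map_segment (x + z) (x + m%:R))).
by rewrite ger0_norm; lra.
Qed.

End CycleMap.

(** * Compact sets, and the action on a Cayley graph *)

Section Compactness.
Variables (R : realType) (Gam : simple_graph).
Implicit Types (K : set (realization R Gam)).
Local Notation vp := (@vertex_point R Gam).

Lemma big_coord (x : realization R Gam) : exists v, 2^-1 <= x v.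
Proof.
have [a [b [s [ab /andP[s0 s1] xE]]]] := coordP x.
have [s2|s2] := leP 2^-1 s; [exists a|exists b]; rewrite xE eqxx mulr1.
  by rewrite ler_wpDr // mulr_ge0 // subr_ge0.
by rewrite ler_wpDl ?mulr_ge0 //; lra.
Qed.

Lemma finite_support (x : realization R Gam) : finite_set [set v | x v != 0].
Proof.
have [a [b [s [_ _ xE]]]] := coordP x.
apply: (@sub_finite_set _ _ [set a; b]); last exact: finite_set2.
move=> v /=; rewrite xE; have [->|_] := eqVneq v a; first by left.
have [->|_] := eqVneq v b; first by right.
by rewrite !mulr0 addr0 eqxx.
Qed.

(** Every point has a vertex where its coordinate is at least 1/2
    ([big_coord]), so that these vertices keep track of the translates of K that
    meet K. *)
Definition near_vertices K : set Gam := [set v | exists2 y, K y & 2^-1 <= y v].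

(** Otherwise the points of K having a coordinate at least 1/2 outside a given
    finite set of vertices would form a filter base, and accumulate at
    some x in K.  But the coordinates of x outside its finite support vanish, and
    coordinates are 1-Lipschitz. *)
Lemma finite_near_vertices K : compact K -> finite_set (near_vertices K).
Proof.
move=> cK; apply: contrapT => inf.
pose B (D : set Gam) := [set y | K y /\ exists v, ~ D v /\ 2^-1 <= y v].
pose F := filter_from (@finite_set Gam) B.
have PF : ProperFilter F.
  apply: filter_from_proper; last first.
    move=> D fD; apply: contrapT => /set0P/negP/negPn/eqP B0; apply: inf.
    apply: sub_finite_set fD => v [y Ky yv]; apply: contrapT => nDv.
    by suff : B D y; [rewrite B0|split=> //; exists v].
  apply: filter_from_filter; first by exists set0; exact: finite_set0.
  move=> D D' fD fD'; exists (D `|` D'); first by rewrite finite_setU.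
  by move=> y [Ky [v [/not_orP[nD nD'] yv]]]; split; split=> //; exists v.
have FK : F K by exists set0 => [|y []]; first exact: finite_set0.
have [x [Kx clx]] := cK F PF FK.
have FB : F (B [set v | x v != 0]).
  by exists [set v | x v != 0] => //; exact: finite_support.
have xb : nbhs x (ball x 4^-1) by apply: nbhsx_ballx; rewrite invr_gt0.
have [y [[_ [v [xv yv]]] [l xy l4]]] := clx _ _ FB xb.
have {}xv : x v = 0 by apply/eqP; apply: contrapT => /negP.
have := le_lt_trans (coord_lipschitz v xy) l4.
by rewrite xv sub0r normrN ltr_norml => /andP[_]; lra.
Qed.

(** The edge is the image of [0, 1] under the walk that goes back and forth
    along it. *)
Lemma closed_edge_compact (u v : Gam) : adj u v ->
  compact (@closed_edge R Gam u v).
Proof.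
move=> uv; pose c (i : int) := if (2 %| i)%Z then u else v.
have adjc i : adj (c i) (c (i + 1)).
  rewrite /c; have -> : (2 %| i + 1)%Z = ~~ (2 %| i)%Z by lia.
  by case: ifP; rewrite //= adj_sym.
rewrite -[closed_edge u v](cycle_map_onto R adjc 0).
apply: continuous_compact; last exact: segment_compact.
exact/continuous_subspaceT/cycle_map_continuous.
Qed.

End Compactness.

Section CayleyAction.
Variables (R : realType) (G : groupType) (S : seq G).
Local Notation Gam := (cayley S).

Lemma cayley_adjM (g u v : G) :
  cayley_adj S u v -> cayley_adj S (g * u)%g (g * v)%g.
Proof.
rewrite /cayley_adj (inj_eq (mulgI g)) !invgM.
by rewrite -!mulgA !(mulgA g^-1%g) mulVg !mul1g.
Qed.

Definition cayley_action : graph_action G Gam :=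
  @GraphAction G Gam (fun g v => g * v)%g (@mul1g G)
    (fun g h v => esym (mulgA g h v)) cayley_adjM.

Lemma cayley_proper : proper_action R cayley_action.
Proof.
move=> K cK; have fK := finite_near_vertices cK.
apply: sub_finite_set (finite_image2 (fun x y : G => x / y)%g fK fK).
move=> g [_ [[y Ky <-] Kgy]]; have [v yv] := big_coord y.
exists (g * v)%g; last exists v; rewrite ?mulgK //; last by exists y.
by exists (act_point cayley_action g y) => //=; rewrite mulKg.
Qed.

Lemma cayley_cocompact : cocompact_action R cayley_action.
Proof.
pose E (s : G) := @closed_edge R Gam 1%g s.
have [K cK SK] : exists2 K : set (realization R Gam), compact K &
    forall s, s \in S -> cayley_adj S 1%g s -> E s `<=` K.
  have h (S' : seq G) : exists2 K : set (realization R Gam), compact K &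
      forall s, s \in S' -> cayley_adj S 1%g s -> E s `<=` K.
    elim: S' => [|s S' [K cK SK]]; first by exists set0; [exact: compact0|].
    have [adj1s|nadj] := boolP (cayley_adj S 1%g s); last first.
      exists K => // r; rewrite inE => /orP[/eqP ->|]; last exact: SK.
      by rewrite (negbTE nadj).
    exists (K `|` E s); first by apply: compactU => //; exact: closed_edge_compact.
    move=> r; rewrite inE => /orP[/eqP -> _|rS ar]; first by move=> x; right.
    by move=> x /(SK r rS ar); left.
  exact: h.
exists (K `|` [set vertex_point R (1%g : Gam)]).
  by apply: compactU => //; exact: compact_set1.
apply/seteqP; split=> // x _.
have edge (u v : Gam) : adj u v -> closed_edge u v x ->
    (u^-1 * v)%g \in S -> (\bigcup_(g in [set: G])
      act_point cayley_action g @` (K `|` [set vertex_point R (1%g : Gam)])) x.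
  move=> uv ex sS; exists u => //; exists (act_point cayley_action u^-1%g x).
    left; apply: (SK _ sS).
      by rewrite -(mulVg u); exact: cayley_adjM.
    move=> w /=; rewrite invgK => /ex[e|<-]; last by right; rewrite mulKg.
    by left; apply: (mulgI u); rewrite e mulg1.
  by apply: realization_eq => w /=; rewrite invgK mulVKg.
have [u [v [s [uv s01 xE]]]] := coordP x; case: uv => [uv|uv].
  exists u => //; exists (vertex_point R (1%g : Gam)); first by right.
  apply: realization_eq => w; rewrite xE -uv -mulrDl addrC subrK mul1r /=.
  by rewrite -(inj_eq (mulgI u)) mulVKg mulg1.
have ex : closed_edge u v x.
  move=> w; rewrite xE; have [->|_] := eqVneq w u; first by left.
  have [->|_] := eqVneq w v; first by right.
  by rewrite !mulr0 addr0 eqxx.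
have /andP[_ /orP[uvS|vuS]] := uv; first exact: edge uv ex uvS.
by apply: edge (closed_edgeC ex) vuS; rewrite adj_sym.
Qed.

Lemma cayley_acts_geometrically : acts_geometrically R G Gam.
Proof.
by exists cayley_action; split; [exact: cayley_proper|exact: cayley_cocompact].
Qed.

End CayleyAction.

(** * Isometric cycles in Cayley graphs *)

Section IsometricVertices.
Variables (R : realType) (Gam : simple_graph).
Hypothesis conG : connected_graph Gam.

(** The metric content of an isometric cycle at its vertices: the second
    condition is an upper bound on distances for all pairs, the third one a lower
    bound along arcs of at most half the length. *)
Definition isometric_walk (n : nat) (c : int -> Gam) : Prop :=
  [/\ forall i, c (i + n%:Z) = c i,
      forall i j (k : nat), `|j - i| <= k%:Z -> reach k (c i) (c j) &
      forall i (d k : nat), (2 * d <= n)%N -> reach k (c i) (c (i + d%:Z)) ->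
        (d <= k)%N].

Lemma circle_dist_small (n : nat) (x y : R) : `|x - y| <= n%:R / 2 ->
  `|x - y| <= circle_dist n x y.
Proof.
move=> small; apply: lb_le_inf; first by eexists; exists 0.
move=> _ [k _ <-]; have [->|k0] := eqVneq k 0; first by rewrite mul0r addr0.
have n0 : 0 <= n%:R :> R by [].
have hk : n%:R <= `|k%:~R * n%:R : R|.
  rewrite normrM (ger0_norm n0) ler_peMl // -intr_norm ler1z.
  by rewrite -gtz0_ge1 normr_gt0.
have := ler_normB (x - y + k%:~R * n%:R) (x - y).
have -> : x - y + k%:~R * n%:R - (x - y) = k%:~R * n%:R by ring.
by lra.
Qed.

Lemma isometric_cycle_walk (n : nat) (f : R -> realization R Gam) :
  isometric_cycle n f -> exists c, isometric_walk n c.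
Proof.
move=> [[n0 per _ vert _] iso].
have /choice[c fc] : forall i : int, exists v, vertex_point R v = f i%:~R.
  by move=> i; have [v _ <-] := vert i; exists v.
exists c; split.
- by move=> i; apply: (@vp_inj R); rewrite !fc intrD -pmulrn per.
- move=> i j k ijk; have [m r] := connected_reach (c i) (c j) conG.
  have [l pl _] := reach_segment R r.
  have [] := @gdist_lt _ _ _ _ l (k%:R + 1) pl.
    rewrite !fc iso; apply: le_lt_trans (circle_dist_le _ _ _ 0) _.
    rewrite mul0r addr0 -intrB -intr_norm distrC.
    by rewrite (le_lt_trans (_ : _ <= k%:~R)) ?ler_int // ltrDl.
  move=> l' pl' l'k; have [m' m'l r'] := segment_reach conG pl'.
  apply: reach_mono r'; have := le_lt_trans m'l l'k.
  by rewrite natr1 ltr_nat ltnS.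
- move=> i d k dn r; have [l pl lk] := reach_segment R r.
  rewrite -(ler_nat R); apply: le_trans lk; apply: le_trans (gdist_le pl).
  rewrite !fc iso; have e : i%:~R - (i + d%:Z)%:~R = - d%:R :> R.
    by rewrite intrD -pmulrn; ring.
  have := @circle_dist_small n i%:~R (i + d%:Z)%:~R.
  rewrite e normrN ger0_norm //; apply.
  by move: dn; rewrite -(ler_nat R) natrM; lra.
Qed.

Lemma isometric_walk_period n c : isometric_walk n c ->
  forall i (k : int), c (i + k * n%:Z) = c i.
Proof.
move=> [per _ _] i k; have P j (m : nat) : c (j + m%:Z * n%:Z) = c j.
  elim: m j => [|m ih] j; first by rewrite mul0r addr0.
  by rewrite -addn1 PoszD mulrDl mul1r addrA per.
case: k => m; first exact: P.
by rewrite -[LHS](P _ m.+1); congr c; rewrite NegzE; ring.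
Qed.

Lemma isometric_walk_adj n c i : (2 <= n)%N -> isometric_walk n c ->
  adj (c i) (c (i + 1)).
Proof.
move=> n2 [per H2 H1]; have r1 : reach 1 (c i) (c (i + 1)).
  by apply: H2; rewrite addrAC subrr add0r.
case: (reach1_inv r1) => // e.
have := H1 i 1%N 0%N; rewrite -e => /(_ _ (reach_refl _ _)); lia.
Qed.

End IsometricVertices.

Lemma cayley_reachM (G : groupType) (S : seq G) n (g u v : cayley S) :
  reach n u v -> reach n ((g : G) * u : cayley S)%g ((g : G) * v : cayley S)%g.
Proof.
elim: n u => [|n ih] u; first by move/reach0 => ->; exact: reach_refl.
case/reach_S => [/ih|[w uw /ih]]; first exact: reach_mono.
rewrite -add1n; apply: reach_trans; apply: reach1; exact: cayley_adjM.
Qed.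

Lemma walk_reach (Gam : simple_graph) (c : nat -> Gam) (r i j : nat) :
  (forall i, (i < r)%N -> adj (c i) (c i.+1)) -> (i <= j <= r)%N ->
  reach (j - i) (c i) (c j).
Proof.
move=> adjc /andP[ij jr]; elim: j ij jr => [|j ih] ij jr.
  by have ->: i = 0%N; [lia|exact: reach_refl].
have [->|nij] := eqVneq i j.+1; first exact: reach_refl.
have -> : (j.+1 - i = (j - i) + 1)%N by lia.
apply: reach_trans (ih _ _) _; try lia.
by apply: reach1; apply: adjc.
Qed.

(** * The generating set {a, t} *)

Section StandardCayley.
Variable R : realType.
Notation lev := (lev R).
Notation pos := (pos R).

Definition standard_gens : seq BS12 := [:: gen_a; gen_t].
Local Notation Gam := (cayley standard_gens).

(** Signs are encoded by booleans, so that [~~ e] reverses the direction. *)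
Definition a_pm (e : bool) : BS12 := if e then gen_a else gen_a^-1%g.
Definition sgn_pm (e : bool) : R := if e then 1 else -1.

Lemma lev_a_pm e : lev (a_pm e) = 0.
Proof. by case: e; rewrite /a_pm !affE ?oppr0. Qed.
Lemma pos_a_pm e : pos (a_pm e) = sgn_pm e.
Proof. by case: e; rewrite /a_pm !affE //= oppr0 expr0z mulr1. Qed.
Lemma a_pmK e : (a_pm e * a_pm (~~ e) = 1)%g.
Proof. by case: e; rewrite /a_pm /= ?mulgV ?mulVg. Qed.
Lemma a_pm_inj g e e' : (g * a_pm e = g * a_pm e')%g -> e = e'.
Proof.
move/mulgI/(congr1 pos); rewrite !pos_a_pm /sgn_pm.
by case: e; case: e' => // h; exfalso; lra.
Qed.

Lemma standard_step (u v : Gam) : adj u v ->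
  [\/ exists e, v = (u * a_pm e)%g, v = (u * gen_t)%g | v = (u * gen_t^-1)%g].
Proof.
have h (x y : BS12) : (x^-1 * y)%g \in standard_gens ->
    y = (x * gen_a)%g \/ y = (x * gen_t)%g.
  rewrite !inE => /orP[|] /eqP /(canRL (mulVKg _)) ->; by [left|right].
move=> /andP[_ /orP[/h|/h]] [->|->].
- by apply: Or31; exists true.
- exact: Or32.
- by apply: Or31; exists false; rewrite /a_pm /= mulgK.
- by apply: Or33; rewrite mulgK.
Qed.

Lemma adj_a_pm (u : Gam) e : @adj Gam u (u * a_pm e)%g.
Proof.
have h (x : BS12) : @adj Gam x (x * gen_a)%g.
  rewrite /= /cayley_adj mulKg !inE eqxx /= andbT.
  apply/eqP => /(congr1 pos); rewrite !affE mulr1 => /eqP.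
  by rewrite -subr_eq0 opprD addrA subrr sub0r oppr_eq0 expfz_eq0 pnatr_eq0 andbF.
case: e; first exact: h.
by rewrite adj_sym; have := h (u / gen_a)%g; rewrite mulgVK.
Qed.

Lemma lev_step (u v : Gam) : adj u v -> `|lev v - lev u| <= 1.
Proof.
by case/standard_step => [[e]||] ->; rewrite !affE ?lev_a_pm; lia.
Qed.

(** The conjugate of a by an element of level k is the translation by 2^k,
    whatever the element.  Hence one left translation moves all horizontal
    edges of level k along themselves ([shearE]), and its square does the same
    at level k + 1 ([shear2E]). *)
Definition shear (g : BS12) e : BS12 := (g * a_pm e * g^-1)%g.

Lemma shear_lev g e : lev (shear g e) = 0.
Proof. by rewrite /shear !affE lev_a_pm; lia. Qed.

Lemma shear_pos g e : pos (shear g e) = sgn_pm e * 2 ^ lev g.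
Proof.
rewrite /shear !affE lev_a_pm pos_a_pm addr0 mulrN mulrA -expfzDr ?pnatr_eq0 //.
by rewrite subrr expr0z; ring.
Qed.

Lemma shear_mul_pos g e h : pos (shear g e * h)%g = sgn_pm e * 2 ^ lev g + pos h.
Proof. by rewrite [LHS]posM shear_lev shear_pos expr0z mul1r. Qed.

Lemma shear_mul_lev g e h : lev (shear g e * h)%g = lev h.
Proof. by rewrite [LHS]levM shear_lev add0r. Qed.

Lemma shearE g e h : lev h = lev g -> (shear g e * h = h * a_pm e)%g.
Proof.
move=> gh; apply: (@BS12_ext R).
  by rewrite shear_mul_pos [RHS]posM pos_a_pm gh; ring.
by rewrite shear_mul_lev [RHS]levM lev_a_pm addr0.
Qed.

Lemma shear2E g e h : lev h = lev g + 1 ->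
  (shear g e * (shear g e * h) = h * a_pm e)%g.
Proof.
move=> gh; apply: (@BS12_ext R).
  rewrite !shear_mul_pos [RHS]posM pos_a_pm gh expfzDr ?pnatr_eq0 // expr1z.
  by ring.
by rewrite !shear_mul_lev [RHS]levM lev_a_pm addr0.
Qed.

Lemma sum_pow2_lt (s : seq int) (M : int) : uniq s ->
  (forall m, m \in s -> m < M) -> \sum_(m <- s) (2 ^ m : R) < 2 ^ M.
Proof.
have p2 (m : int) : 0 < 2 ^ m :> R by rewrite exprz_gt0.
have p2S (m : int) : 2 ^ m = 2 ^ (m - 1) + 2 ^ (m - 1) :> R.
  by rewrite -{1}(subrK 1 m) expfzDr ?pnatr_eq0 // expr1z; ring.
have [N hN] : exists N : nat, forall m, m \in s -> M - N%:Z <= m.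
  elim: s => [|m s [N ih]]; first by exists 0%N.
  exists (maxn N `|M - m|%N) => m'; rewrite inE => /orP[/eqP ->|/ih]; lia.
elim: N s M hN => [|N ih] s M hN us sM.
  have -> : s = [::].
    by case: s hN sM {us} => // m s /(_ m (mem_head _ _)) + /(_ m (mem_head _ _)); lia.
  by rewrite big_nil.
have [Ms|nMs] := boolP ((M - 1) \in s); last first.
  apply: lt_trans (ih s (M - 1) _ us _) _ => [m ms|m ms|].
  - by have := hN m ms; lia.
  - have := sM m ms; have : m != M - 1 by apply: contraNneq nMs => <-.
    by lia.
  - by rewrite [ltRHS]p2S ltrDl.
rewrite (big_rem _ Ms) /= [ltRHS]p2S ltrD2l; apply: ih.
- by move=> m /mem_rem /hN; lia.
- exact: rem_uniq.
- move=> m; rewrite mem_rem_uniq // inE => /andP[/eqP mM /sM]; lia.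
Qed.

Section Segment.
Variables (c : nat -> Gam) (r : nat) (M : int).
Hypothesis adjc : forall i, (i < r)%N -> adj (c i) (c i.+1).
Hypothesis geod : forall k, reach k (c 0%N) (c r) -> (r <= k)%N.
Hypothesis lev0 : lev (c 0%N) = M.
Hypothesis lev_le : forall i, (i <= r)%N -> lev (c i) <= M.

(** Levels change by at most one along an edge, so no level is skipped. *)
Lemma level_crossing m i : m < M -> (i <= r)%N -> lev (c i) <= m ->
  exists2 l, (l < i)%N & lev (c l) = m + 1.
Proof.
move=> mM; elim: i => [|i ih] ir; first by rewrite lev0; lia.
have [im _|im ie] := leP (lev (c i)) m.
  by have [l li e] := ih (ltnW ir) im; exists l => //; exact: ltnW.
by exists i => //; have := lev_step (adjc ir); lia.
Qed.

(** The two edges are moved by the same left translation z, an isometry.  If they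
    are opposite, applying z to the part between them yields a walk shorter
    by two.  If they are parallel, the walk has crossed level [lev (c i) + 1] before:
    a horizontal edge inserted there moves the rest by z^2, which is twice what each
    of the two edges does, and both can be removed. *)
Lemma geodesic_level_unique i j e1 e2 : (i < j < r)%N ->
  c i.+1 = (c i * a_pm e1)%g -> c j.+1 = (c j * a_pm e2)%g ->
  lev (c i) = lev (c j) -> lev (c i) < M -> False.
Proof.
move=> /andP[ij jr] ei ej lij iM; have R_ := walk_reach adjc.
have rmul z k (u v : Gam) : reach k u v ->
  reach k ((z : BS12) * u : Gam)%g ((z : BS12) * v : Gam)%g by exact: cayley_reachM.
have r1 : reach i (c 0%N) (c i) by rewrite -[X in reach X](subn0 i); apply: R_; lia.
have r2 : reach (j - i.+1) (c i.+1) (c j) by apply: R_; lia.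
have r3 : reach (r - j.+1) (c j.+1) (c r) by apply: R_; lia.
have [ee|ne] := eqVneq e1 e2; last first.
  (* Opposite directions. *)
  pose z := shear (c i) e2.
  have zi : (z * c i.+1)%g = c i.
    rewrite /z shearE; last by rewrite ei levM lev_a_pm addr0.
    rewrite ei -mulgA; have -> : e2 = ~~ e1 by case: (e1) (e2) ne => [] [].
    by rewrite a_pmK mulg1.
  have zj : (z * c j)%g = c j.+1 by rewrite /z shearE // ej.
  have zr2 := rmul z _ _ _ r2; rewrite zi zj in zr2.
  by have /geod := reach_trans (reach_trans r1 zr2) r3; lia.
(* Equal directions: the new edge is inserted after c l. *)
subst e2; have [l li el] := level_crossing iM (ltnW (ltn_trans ij jr)) (lexx _).
pose z := shear (c i) e1.
have zi : (z * c i)%g = c i.+1 by rewrite /z shearE // ei.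
have zj : (z * c j)%g = c j.+1 by rewrite /z shearE // ej.
have zl : (z * (z * c l))%g = (c l * a_pm e1)%g by rewrite /z shear2E.
have s1 : reach l (c 0%N) (c l) by rewrite -[X in reach X](subn0 l); apply: R_; lia.
have s2 : reach (i - l) (c l) (c i) by apply: R_; lia.
have zs2 := rmul z _ _ _ (rmul z _ _ _ s2).
rewrite zl zi in zs2.
have zr2 := rmul z _ _ _ r2; rewrite zj in zr2.
have e1r := reach1 (adj_a_pm (c l) e1).
have := reach_trans (reach_trans (reach_trans (reach_trans s1 e1r) zs2) zr2) r3.
move/geod; lia.
Qed.

Lemma horizontal_step i : (i < r)%N -> pos (c i.+1) != pos (c i) ->
  exists e, c i.+1 = (c i * a_pm e)%g.
Proof.
move=> ir; case: (standard_step (adjc ir)) => [//| |] ->.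
  by rewrite posM pos_t mulr0 addr0 eqxx.
by rewrite posM posV pos_t mulr0 oppr0 mulr0 addr0 eqxx.
Qed.

(** Steps at level M go in the direction of e by assumption, and the steps below
    M have distinct levels, so that they add up to less than 2^M. *)
Lemma segment_drift e :
  (forall i, (i < r)%N -> lev (c i) = M -> c i.+1 = (c i * a_pm (~~ e))%g -> False) ->
  - 2 ^ M < sgn_pm e * (pos (c r) - pos (c 0%N)).
Proof.
move=> noneg.
pose p i := (pos (c i.+1) != pos (c i)) && (lev (c i) < M).
pose s := [seq i <- index_iota 0 r | p i].
have sP i : i \in s -> [/\ (i < r)%N, lev (c i) < M &
    exists e, c i.+1 = (c i * a_pm e)%g].
  rewrite mem_filter mem_index_iota => /andP[/andP[h1 h2] h3].
  by split=> //; exact: horizontal_step.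
have us : uniq [seq lev (c i) | i <- s].
  rewrite map_inj_in_uniq ?filter_uniq ?iota_uniq // => i j.
  wlog ij : i j / (i < j)%N.
    move=> h iS jS lij; have [/h h1|/h h2|//] := ltngtP i j; first exact: h1.
    by apply/esym; exact: h2.
  move=> /sP[ir iM [e1 E1]] /sP[jr jM [e2 E2]] lij; exfalso.
  by apply: (geodesic_level_unique _ E1 E2 lij iM); rewrite ij jr.
have lt := sum_pow2_lt us.
have {lt}/lt : forall m, m \in [seq lev (c i) | i <- s] -> m < M.
  by move=> m /mapP[i /sP[_ iM _] ->].
rewrite big_map /s big_filter => lt.
rewrite -(telescope_sumr (fun i => pos (c i)) (leq0n r)) mulr_sumr ltrNl.
apply: le_lt_trans lt.
rewrite -sumrN [leRHS]big_mkcond /=; apply: ler_sum_nat => i /andP[_ ir].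
have p2 : 0 < 2 ^ lev (c i) :> R by rewrite exprz_gt0.
have [same|ne] := eqVneq (pos (c i.+1)) (pos (c i)).
  by rewrite /p same eqxx subrr mulr0 oppr0.
have [e' E'] := horizontal_step ir ne.
have d : pos (c i.+1) - pos (c i) = 2 ^ lev (c i) * sgn_pm e'.
  by rewrite E' [pos (_ * _)%g]posM pos_a_pm; ring.
rewrite /p ne /= d; case: ltrP => iM.
  by move: p2; rewrite /sgn_pm; case: (e); case: (e'); lra.
have {}iM : lev (c i) = M by apply/le_anti; rewrite iM lev_le // ltnW.
have -> : e' = e.
  apply: contrapT => ee; apply: (noneg i ir iM); rewrite E'.
  by congr (_ * a_pm _)%g; case: (e) (e') ee => [] [].
by move: p2; rewrite /sgn_pm; case: (e); lra.
Qed.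

End Segment.

Section IsometricCycle.
Variables (n : nat) (c : int -> Gam).
Hypothesis iso : isometric_walk n c.
Hypothesis n6 : (6 <= n)%N.

Let n2 : (2 <= n)%N. Proof. lia. Qed.
Let adjc i := isometric_walk_adj i n2 iso.

Lemma isometric_no_repeat i (d : nat) k : (2 * d <= n)%N -> (k < d)%N ->
  reach k (c i) (c (i + d%:Z)) -> False.
Proof. by move=> dn kd; have [_ _ H1] := iso; move/(H1 _ _ _ dn); lia. Qed.

Lemma isometric_no_backtrack i : c i = c (i + 2) -> False.
Proof.
move=> e; apply: (@isometric_no_repeat i 2 0); try lia.
by rewrite -e; exact: reach_refl.
Qed.

Lemma top_level : exists i0, forall i, lev (c i) <= lev (c i0).
Proof.
pose F (i : 'I_n.-1.+1) := lev (c (i : nat)%:Z).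
have [i0 _ max] := @Order.TotalTheory.arg_maxP _ _ _ (@ord0 n.-1) predT F isT.
exists (i0 : nat)%:Z => i.
have m0 : 0 <= (i %% n%:Z)%Z by rewrite modz_ge0; lia.
have mn : (`|(i %% n%:Z)%Z|%N < n.-1.+1)%N.
  by have := @ltz_pmod i n%:Z; lia.
have := max (Ordinal mn) isT; rewrite /F /= gez0_abs //.
have e : i = (i %% n%:Z)%Z + (i %/ n%:Z)%Z * n%:Z by rewrite addrC -divz_eq.
by rewrite {2}e (isometric_walk_period iso).
Qed.

(** The cycle arrives at level M by t and cannot leave at once, which would be
    backtracking, nor after one step, since t a t^-1 = a^2 is a shortcut. *)
Lemma top_run M i0 : lev (c i0) = M -> (forall i, lev (c i) <= M) ->
  exists j e, [/\ lev (c j) = M, c (j + 1) = (c j * a_pm e)%g &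
    c (j + 2) = (c (j + 1) * a_pm e)%g].
Proof.
move=> l0 max.
have same j e e' : c (j + 1) = (c j * a_pm e)%g ->
    c (j + 2) = (c (j + 1) * a_pm e')%g -> e' = e.
  move=> E E'; apply: contrapT => ee; apply: (@isometric_no_backtrack j).
  rewrite E' E -mulgA; have -> : e' = ~~ e by case: (e) (e') ee => [] [].
  by rewrite a_pmK mulg1.
have noup j : lev (c j) = M -> c (j + 1) = (c j * gen_t)%g -> False.
  by move=> lj E; have := max (j + 1); rewrite E levM lev_t lj; lia.
have adjS j k : k = j + 1 -> adj (c j) (c k) by move=> ->; exact: adjc.
have [allM|] := pselect (forall i, lev (c i) = M).
  exists 0; have hor j : exists e, c (j + 1) = (c j * a_pm e)%g.
    case: (standard_step (adjc j)) => // E; first by case: (noup j).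
    by have := allM (j + 1); rewrite E levM levV lev_t allM; lia.
  have [e E] := hor 0; have [e' E'] := hor (0 + 1).
  by exists e; split=> //; rewrite -(same _ _ _ E E').
move/existsNP => [i1 l1].
have [j [lj lj1]] : exists j, lev (c j) < M /\ lev (c (j + 1)) = M.
  have {}l1 : lev (c i1) < M by have := max i1; lia.
  pose d := `|(i0 + `|i1 - i0|%R * n%:Z - i1)%R|%N.
  have Ed : i1 + d%:Z = i0 + `|i1 - i0| * n%:Z by rewrite /d; nia.
  have : lev (c (i1 + d%:Z)) = M by rewrite Ed (isometric_walk_period iso).
  elim: d {Ed} => [|d ih]; first by rewrite addr0; lia.
  have [ld _|ld e] := eqVneq (lev (c (i1 + d%:Z))) M; first exact: ih.
  exists (i1 + d%:Z); split; first by have := max (i1 + d%:Z); lia.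
  by rewrite -e -addn1 PoszD addrA.
have E1 : c (j + 1) = (c j * gen_t)%g.
  case: (standard_step (adjc j)) => [[e]|//|] E; move: lj1; rewrite E levM.
    by rewrite lev_a_pm; lia.
  by rewrite levV lev_t; lia.
have [e E2] : exists e, c (j + 2) = (c (j + 1) * a_pm e)%g.
  case: (standard_step (adjS (j + 1) (j + 2) _)) => //; first by lia.
    by move=> E; case: (noup (j + 1)) => //; rewrite -E; congr c; lia.
  move=> E; case: (@isometric_no_backtrack j).
  by rewrite E E1 mulgK.
have l2 : lev (c (j + 2)) = M by rewrite E2 levM lev_a_pm addr0.
exists (j + 1), e; split=> //; first by rewrite -E2; congr c; lia.
have [e' E3] : exists e', c (j + 3) = (c (j + 2) * a_pm e')%g.
  case: (standard_step (adjS (j + 2) (j + 3) _)) => //; first by lia.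
    by move=> E; case: (noup (j + 2)) => //; rewrite -E; congr c; lia.
  move=> E; case: (@isometric_no_repeat j 3 2); try lia.
  have -> : c (j + 3%:Z) = (c j * a_pm e * a_pm e)%g.
    rewrite E E2 E1; apply: (@BS12_ext R); rewrite !(posM, levM, posV, levV).
      rewrite !(lev_t, pos_t, lev_a_pm, pos_a_pm) !(mulr0, oppr0, addr0).
      by rewrite expfzDr ?pnatr_eq0 // expr1z; ring.
    by rewrite !(lev_t, lev_a_pm); ring.
  exact: (reach_trans (reach1 (adj_a_pm _ _)) (reach1 (adj_a_pm _ _))).
have E3' : c (j + 1 + 2) = (c (j + 1 + 1) * a_pm e')%g.
  have -> : j + 1 + 2 = j + 3 by lia.
  by have -> : j + 1 + 1 = j + 2 by lia.
have E2' : c (j + 1 + 1) = (c (j + 1) * a_pm e)%g.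
  by rewrite -E2; congr c; lia.
by rewrite E3' (same _ _ _ E2' E3').
Qed.

(** Let d be the distance from c j0 to c j along the cycle.  The translation that
    moves both edges shows that the arc from c j0 to c (j + 1) and the arc from
    c (j0 + 1) to c j span the same distance, although the lengths of these arcs
    differ by two.  This leaves only the antipodal position; but the edge that
    ends at c j0 is parallel to the one that starts there, and the opposite edge
    cannot be antipodal to both. *)
Lemma no_opposite_edge j0 e j : c j0 = (c (j0 - 1) * a_pm e)%g ->
  c (j0 + 1) = (c j0 * a_pm e)%g -> c (j + 1) = (c j * a_pm (~~ e))%g ->
  lev (c j) = lev (c j0) -> False.
Proof.
move=> E0 E1 Ej lj.
wlog j01 : j Ej lj / j0 <= j < j0 + n%:Z.
  have em : j0 + ((j - j0) %% n%:Z)%Z = j + (- ((j - j0) %/ n%:Z)%Z) * n%:Z.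
    have := divz_eq (j - j0) n%:Z; lia.
  have m0 : 0 <= ((j - j0) %% n%:Z)%Z by rewrite modz_ge0; lia.
  have mn : ((j - j0) %% n%:Z)%Z < n%:Z by apply: ltz_pmod; lia.
  move=> hw; apply: (hw (j0 + ((j - j0) %% n%:Z)%Z)).
  - by rewrite em addrAC !(isometric_walk_period iso).
  - by rewrite em (isometric_walk_period iso).
  - by rewrite lerDl m0 ltrD2l mn.
have [d Ed] : exists d : nat, j = j0 + d%:Z by exists `|j - j0|%N; lia.
subst j; have dn : (d < n)%N by lia.
have per := isometric_walk_period iso; have [_ H2 _] := iso.
have ee : ~~ e = e -> False by case: (e).
have d0 : d != 0%N.
  apply/eqP => d0; apply/ee/(@a_pm_inj (c j0)).
  by rewrite -E1; move: Ej; rewrite d0 addr0 => ->.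
have d1 : d != n.-1.
  apply/eqP => d1; apply/ee/(@a_pm_inj (c (j0 - 1))); rewrite -E0.
  have e1 : c (j0 + d%:Z) = c (j0 - 1) by rewrite -(per (j0 - 1) 1) d1; congr c; lia.
  have e2 : c (j0 + d%:Z + 1) = c j0 by rewrite -(per j0 1) d1; congr c; lia.
  by rewrite -e1 -Ej e2.
pose z := shear (c j0) e.
have l0 : lev (c (j0 - 1)) = lev (c j0) by rewrite E0 levM lev_a_pm addr0.
have z0 : (z * c (j0 - 1))%g = c j0 by rewrite /z shearE // E0.
have z1 : (z * c j0)%g = c (j0 + 1) by rewrite /z shearE // E1.
have zj : (z * c (j0 + d%:Z + 1))%g = c (j0 + d%:Z).
  rewrite /z shearE; last by rewrite Ej levM lev_a_pm addr0.
  rewrite Ej -mulgA; have {2}-> : e = ~~ ~~ e by rewrite negbK.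
  by rewrite a_pmK mulg1.
have cancel k (u v : Gam) : reach k (z * u : Gam)%g (z * v : Gam)%g -> reach k u v.
  by move/(@cayley_reachM _ _ _ (z^-1%g : Gam)); rewrite !mulKg.
have [big|small] := leqP n (2 * d).
  (* The arc of length n - d from c j to c (j0 + n), and the one inside it. *)
  have r : reach (n - d - 2) (c (j0 + d%:Z)) (c (j0 + n%:Z)).
    have -> : c (j0 + n%:Z) = c j0 by rewrite -[RHS](per _ 1) mul1r.
    rewrite -zj -z0; apply: cayley_reachM; rewrite -(per (j0 - 1) 1).
    by apply: H2; lia.
  apply: (@isometric_no_repeat (j0 + d%:Z) (n - d) (n - d - 2)); try lia.
  by have -> : j0 + d%:Z + (n - d)%:Z = j0 + n%:Z by lia.
have r : reach (d - 1) (c j0) (c (j0 + d%:Z + 1)).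
  by apply: cancel; rewrite z1 zj; apply: H2; lia.
have [small'|big'] := leqP (2 * d.+1) n.
  apply: (@isometric_no_repeat j0 d.+1 (d - 1)); try lia.
  by have -> : j0 + d.+1%:Z = j0 + d%:Z + 1 by lia.
apply: (@isometric_no_repeat (j0 + d%:Z + 1) d (d - 1)); try lia.
have -> : j0 + d%:Z + 1 + d%:Z = j0 + 1 * n%:Z by lia.
by rewrite per; exact: reach_sym.
Qed.

(** Starting from c j0, between two parallel edges of top level M, the
    cycle is followed in both directions until its two halves meet.  By
    [segment_drift] the meeting point would lie strictly on both sides of
    c j0. *)
Lemma no_long_isometric_walk : False.
Proof.
have [i0 max] := top_level.
have [j [e [lj Ej1 Ej2]]] := top_run erefl max.
set M := lev (c i0) in max lj.
pose j0 := j + 1.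
have E0 : c j0 = (c (j0 - 1) * a_pm e)%g by rewrite /j0 addrK.
have E1 : c (j0 + 1) = (c j0 * a_pm e)%g.
  by rewrite /j0 -Ej2; congr c; lia.
have l0 : lev (c j0) = M by rewrite E0 levM lev_a_pm addr0 /j0 addrK.
have noopp i : c (i + 1) = (c i * a_pm (~~ e))%g -> lev (c i) = M -> False.
  by move=> E l; apply: (no_opposite_edge E0 E1 E); rewrite l0.
have [_ _ H1] := iso.
pose r := (n %/ 2)%N; pose r' := (n - 2 - r)%N.
have fwd := @segment_drift (fun i => c (j0 + 1 + i%:Z)) r M _ _ _ _ e _.
have bwd := @segment_drift (fun i => c (j0 - 1 - i%:Z)) r' M _ _ _ _ (~~ e) _.
have {}fwd : - 2 ^ M < sgn_pm e * (pos (c (j0 + 1 + r%:Z)) - pos (c (j0 + 1))).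
  move: fwd; rewrite addr0; apply.
  - by move=> i _; rewrite -addn1 PoszD addrA; exact: adjc.
  - by move=> k; apply: H1; rewrite /r; lia.
  - by rewrite E1 levM lev_a_pm addr0.
  - by move=> i _.
  - by move=> i _ l E; apply: (noopp _ _ l); rewrite -E -addn1 PoszD addrA.
have {}bwd : - 2 ^ M < sgn_pm (~~ e) * (pos (c (j0 - 1 - r'%:Z)) - pos (c (j0 - 1))).
  move: bwd; rewrite subr0; apply.
  - move=> i _; rewrite adj_sym; have := adjc (j0 - 1 - i.+1%:Z).
    by congr (adj _ (c _)); lia.
  - move=> k /reach_sym rr; apply: (H1 (j0 - 1 - r'%:Z)); first by rewrite /r' /r; lia.
    by rewrite subrK.
  - by rewrite /j0 addrK.
  - by move=> i _.
  - move=> i _ l; rewrite negbK => E; apply: (noopp (j0 - 1 - i.+1%:Z)).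
      have -> : j0 - 1 - i.+1%:Z + 1 = j0 - 1 - i%:Z by lia.
      by rewrite E -mulgA a_pmK mulg1.
    by rewrite E levM lev_a_pm l addr0.
have same : c (j0 + 1 + r%:Z) = c (j0 - 1 - r'%:Z).
  rewrite -[RHS](isometric_walk_period iso _ 1); congr c; rewrite /r' /r; lia.
move: fwd bwd; rewrite same E1 [pos (c j0 * _)%g]posM pos_a_pm l0.
have -> : pos (c j0) = pos (c (j0 - 1)) + 2 ^ M * sgn_pm e.
  by rewrite {1}E0 posM pos_a_pm; congr (_ + 2 ^ _ * _); rewrite /j0 addrK.
have p2 : 0 < 2 ^ M :> R by rewrite exprz_gt0.
by rewrite /sgn_pm; case: (e) => /=; lra.
Qed.

End IsometricCycle.

Lemma generates_standard : generates standard_gens.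
Proof.
by apply: generates_gen => H _ SH; split; apply: SH; rewrite !inE eqxx ?orbT.
Qed.

Lemma shortcut_standard : shortcut R (cayley standard_gens).
Proof.
exists 5%N => n f iso; rewrite leqNgt; apply/negP => n6.
have [c w] := isometric_cycle_walk (cayley_connected generates_standard) iso.
exact: (no_long_isometric_walk w).
Qed.

Lemma shortcut_group_BS12 : shortcut_group R BS12.
Proof.
exists (cayley standard_gens); split.
- exact: cayley_connected generates_standard.
- exact: shortcut_standard.
- exact: cayley_acts_geometrically.
Qed.

End StandardCayley.

(** * The generating set {t, at, a^-1 t} *)

Section HorocyclicCayley.
Variable R : realType.
Notation lev := (lev R).
Notation pos := (pos R).

(** Every change of level may carry a horizontal move in either direction, so
    that the length of the cycle below consists of changes of level only. *)
Definition vertical_gens : seq BS12 :=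
  [:: gen_t; (gen_a * gen_t)%g; (gen_a^-1 * gen_t)%g].
Local Notation Gam := (cayley vertical_gens).

Lemma generates_vertical : generates vertical_gens.
Proof.
apply: generates_gen => H Hg SH.
have tH : gen_t \in H by apply: SH; rewrite !inE eqxx.
split=> //; have HM := group_closedM Hg; have HV := group_closedV Hg.
rewrite -[gen_a](mulgK gen_t); apply: HM; last exact: HV.
by apply: SH; rewrite !inE eqxx orbT.
Qed.

Lemma up_step (u v : BS12) : (u^-1 * v)%g \in vertical_gens -> lev v = lev u + 1 /\
  exists2 e : int, `|e| <= 1 & pos v = pos u + e%:~R * 2 ^ lev u.
Proof.
have E x : v = (u * (x * gen_t))%g -> lev x = 0 -> lev v = lev u + 1 /\
    pos v = pos u + pos x * 2 ^ lev u.
  by move=> -> x0; rewrite !affE x0; split; [ring|rewrite mulr0 addr0 mulrC].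
rewrite !inE => /or3P[] /eqP /(canRL (mulVKg _)) Ev.
- rewrite -[gen_t]mul1g in Ev.
  have [-> ->] := E _ Ev (lev1 R); split=> //.
  by exists 0; rewrite ?pos1 // mul0r mulr0z mul0r.
- have [-> ->] := E _ Ev (lev_a R); split=> //.
  by exists 1; rewrite ?pos_a.
- have [|-> ->] := E _ Ev; first by rewrite !affE.
  split=> //; exists (- 1); rewrite // !affE ?oppr0 ?expr0z ?mul1r ?mulr1.
  by rewrite mulrNz.
Qed.

Lemma vertical_step (u v : Gam) : adj u v ->
  (lev v = lev u + 1 /\
     exists2 e : int, `|e| <= 1 & pos v = pos u + e%:~R * 2 ^ lev u) \/
  (lev u = lev v + 1 /\
     exists2 e : int, `|e| <= 1 & pos u = pos v + e%:~R * 2 ^ lev v).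
Proof. by move=> /andP[_ /orP[/up_step|/up_step]]; [left|right]. Qed.

Let p2gt0 (k : int) : 0 < 2 ^ k :> R. Proof. by rewrite exprz_gt0. Qed.
Let p2D (k : int) (n : nat) : 2 ^ (k + n%:Z) = 2 ^ k * 2 ^+ n :> R.
Proof. by rewrite expfzDr ?pnatr_eq0. Qed.
Let p2ge1 (n : nat) : 1 <= 2 ^+ n :> R. Proof. by rewrite exprn_ege1 // ler1n. Qed.

Lemma step_bound (e : int) (x y p : R) : 0 < p -> `|e| <= 1 ->
  x = y + e%:~R * p -> `|x - y| <= p.
Proof.
move=> p0 e1 ->; rewrite addrC addKr normrM (gtr0_norm p0) ler_piMl ?(ltW p0) //.
by rewrite -intr_norm lerz1.
Qed.

(** The r-th step up of a walk that starts at level k is taken from level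
    k + r - 1 at most, so that the U steps up move the abscissa by at most
    2^k (2^U - 1); the D steps down are treated by reading the walk backwards. *)
Lemma walk_displacement (u : Gam) s : path (@adj Gam) u s -> exists U D : nat,
  [/\ size s = (U + D)%N, lev (last u s) = lev u + U%:Z - D%:Z &
      `|pos (last u s) - pos u| <=
         2 ^ lev u * (2 ^+ U - 1) + 2 ^ lev (last u s) * (2 ^+ D - 1)].
Proof.
elim: s u => [|w s ih] u /=.
  by exists 0%N, 0%N; rewrite subrr normr0 !expr0 subrr !mulr0 addr0; split=> //; lia.
move=> /andP[uw /ih[U [D [sz lv bd]]]]; set v := last w s in lv bd *.
have tri : `|pos v - pos u| <= `|pos v - pos w| + `|pos w - pos u|.
  have -> : pos v - pos u = (pos v - pos w) + (pos w - pos u) by ring.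
  exact: ler_normD.
case: (vertical_step uw) => [[lw [e e1 pe]]|[lw [e e1 pe]]].
  exists U.+1, D; split; [by rewrite sz|by rewrite lv lw; lia|].
  have := step_bound (p2gt0 _) e1 pe; move: bd tri.
  rewrite lw (p2D _ 1) expr1 [2 ^+ U.+1]exprS.
  move: (2 ^ lev u) (2 ^+ U) (2 ^ lev v * _) => x y z; lra.
exists U, D.+1; split; [by rewrite sz addnS|by rewrite lv lw; lia|].
have := step_bound (p2gt0 _) e1 pe; rewrite distrC; move: bd tri.
have : 2 ^ lev v * 2 ^+ D = 2 ^ lev w * 2 ^+ U :> R.
  by rewrite -!p2D lv; congr (_ ^ _); ring.
rewrite lw (p2D _ 1) expr1 [2 ^+ D.+1]exprS.
have := p2ge1 U; have := p2gt0 (lev w).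
move: (2 ^ lev w) (2 ^+ U) (2 ^ lev v) (2 ^+ D) => x y z t; nra.
Qed.

(** A step between positive levels moves the abscissa by an even integer. *)
Lemma walk_parity (u : Gam) s : path (@adj Gam) u s -> 0 <= lev u ->
  (exists z : int, pos (last u s) - pos u = z%:~R * 2) \/
  exists s1 s2, s = s1 ++ s2 /\ lev (last u s1) = 0.
Proof.
elim: s u => [|w s ih] u /=; first by left; exists 0; rewrite subrr mul0r.
move=> /andP[uw ps] u0; have [lu0|lu0] := eqVneq (lev u) 0.
  by right; exists [::], (w :: s).
have [lw0|lw0] := eqVneq (lev w) 0; first by right; exists [:: w], s.
have even (k : int) (e : int) : 0 < k -> exists z : int, e%:~R * 2 ^ k = z%:~R * 2 :> R.
  move=> k0; exists (e * 2 ^+ `|k - 1|%N).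
  have {1}-> : k = 1 + `|k - 1|%N%:Z by lia.
  by rewrite p2D expr1z intrM rmorphXn /=; ring.
have w0 : 0 <= lev w by case: (vertical_step uw) => [[lw _]|[lw _]]; lia.
case: (ih w ps w0) => [[z Ez]|[s1 [s2 [-> l0]]]]; last first.
  by right; exists (w :: s1), s2.
left; have -> : pos (last w s) - pos u = z%:~R * 2 + (pos w - pos u).
  by rewrite -Ez; ring.
case: (vertical_step uw) => [[lw [e _ ->]]|[lw [e _ ->]]].
  have [|y Ey] := even (lev u) e; first by lia.
  by exists (z + y); rewrite Ey intrD; ring.
have [|y Ey] := even (lev w) e; first by lia.
by exists (z - y); rewrite Ey intrD mulrNz; ring.
Qed.

(** A walk between u and v passes through level 0, by parity, so that it has
    at least [lev u] steps up.  Summing [walk_displacement] over the two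
    parts, a walk with N steps up moves the abscissa by at most
    2 (2^N - 1). *)
Lemma vertical_far (h : nat) (u v : Gam) k : reach k u v -> lev v = lev u ->
  0 <= lev u -> (forall z : int, pos v - pos u = z%:~R * 2 -> False) ->
  lev u = h%:Z \/ 2 ^+ h - 1 <= `|pos v - pos u| -> (2 * h <= k)%N.
Proof.
move=> [s [ps ls sk]] luv u0 odd far; apply: leq_trans sk.
case: (walk_parity ps u0) => [[z]|[s1 [s2 [Es l0]]]].
  by rewrite ls => /odd.
move: ps ls; rewrite Es cat_path last_cat => /andP[ps1 ps2] ls.
have [U1 [D1 [sz1 lv1 bd1]]] := walk_displacement ps1.
have [U2 [D2 [sz2 lv2 bd2]]] := walk_displacement ps2.
set w := last u s1 in lv1 bd1 lv2 bd2 l0 ls; rewrite ls luv l0 in lv1 bd1 lv2 bd2.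
rewrite size_cat sz1 sz2.
have [K EK] : exists K : nat, lev u = K%:Z by exists `|lev u|%N; lia.
rewrite EK in lv1 lv2 far bd1 bd2 *.
case: far => [[hK]|far]; first by lia.
rewrite leqNgt; apply/negP => small.
have tri : `|pos v - pos u| <= `|pos v - pos w| + `|pos w - pos u|.
  have -> : pos v - pos u = (pos v - pos w) + (pos w - pos u) by ring.
  exact: ler_normD.
have ED1 : D1 = (U1 + K)%N by lia.
have EU2 : U2 = (D2 + K)%N by lia.
have : 2 ^+ (U1 + D2 + K).+1 <= 2 ^+ h :> R by rewrite ler_weXn2l ?ler1n //; lia.
move: far tri bd1 bd2; rewrite ED1 EU2 expr0z -exprnP !exprS !exprD.
have := p2ge1 U1; have := p2ge1 D2; have := p2ge1 K.
move: (2 ^+ U1) (2 ^+ D2) (2 ^+ K) (2 ^+ h) => x y z t z1 y1 x1.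
have : 0 <= z * ((x - 1) * (y - 1)) by rewrite !mulr_ge0 ?subr_ge0 //; lra.
by move: `|_| `|_| `|_| => A B C; lra.
Qed.

Definition vtx (b k : nat) : BS12 := (gen_a ^+ b * gen_t ^+ k)%g.

Lemma vtx_pos b k : pos (vtx b k) = b%:R.
Proof. by rewrite /vtx !affE mulr0 addr0. Qed.

Lemma vtx_lev b k : lev (vtx b k) = k%:Z.
Proof. by rewrite /vtx !affE; lia. Qed.

Lemma vtx_far (h b b' k r : nat) : reach r (vtx b k : Gam) (vtx b' k : Gam) ->
  odd (b + b') -> k = h \/ (b + 2 ^ h <= b'.+1)%N \/ (b' + 2 ^ h <= b.+1)%N ->
  (2 * h <= r)%N.
Proof.
move=> rr odd_ far; apply: (vertical_far rr); rewrite ?vtx_lev ?vtx_pos //.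
  move=> z; have -> : b'%:R - b%:R = (b'%:Z - b%:Z)%:~R :> R.
    by rewrite intrB -!pmulrn.
  have -> : z%:~R * 2 = (z * 2)%:~R :> R by rewrite intrM.
  by move=> /intr_inj; lia.
case: far => [->|far]; [by left|right].
have h2 : (2 ^ h)%:R = 2 ^+ h :> R by rewrite natrX.
case: far; rewrite -(ler_nat R) natrD -natr1 h2 => far.
  by rewrite ler_normr; apply/orP; left; lra.
by rewrite ler_normr; apply/orP; right; lra.
Qed.

Lemma vtx_adj b b' k :
  [\/ b' = b, b' = (b + 2 ^ k)%N | b = (b' + 2 ^ k)%N] ->
  @adj Gam (vtx b k) (vtx b' k.+1).
Proof.
move=> E; have d : ((vtx b k)^-1 * vtx b' k.+1)%g \in vertical_gens ->
    @adj Gam (vtx b k) (vtx b' k.+1).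
  move=> h; rewrite /= /cayley_adj h andbT; apply/eqP => /(congr1 lev).
  by rewrite !vtx_lev; lia.
apply: d; have up x : (vtx b k * (x * gen_t) = vtx b' k.+1)%g ->
   (x * gen_t)%g \in vertical_gens -> ((vtx b k)^-1 * vtx b' k.+1)%g \in vertical_gens.
  by move=> <-; rewrite mulKg.
have ext x : lev x = 0 -> b'%:R = b%:R + pos x * 2 ^+ k ->
   (vtx b k * (x * gen_t) = vtx b' k.+1)%g.
  move=> lx px; apply: (@BS12_ext R).
    rewrite [LHS]posM [pos (x * gen_t)%g]posM !vtx_pos vtx_lev px pos_t.
    by rewrite mulr0 addr0 mulrC -exprnP.
  by rewrite [LHS]levM [lev (x * gen_t)%g]levM !vtx_lev lx lev_t; lia.
case: E => E.
- apply: (up 1%g); last by rewrite mul1g !inE eqxx.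
  by apply: ext; rewrite ?lev1 // pos1 E mul0r addr0.
- apply: (up gen_a); last by rewrite !inE eqxx orbT.
  by apply: ext; rewrite ?lev_a // pos_a E natrD natrX mul1r.
- apply: (up gen_a^-1)%g; last by rewrite !inE eqxx !orbT.
  apply: ext; first by rewrite levV lev_a oppr0.
  by rewrite E natrD natrX !affE oppr0 expr0z; ring.
Qed.

(** The first half climbs from (0, 0) to (2^h - 1, h) and descends to
    (2^(h+1) - 3, 0), every edge moving to the right except the last one, which is
    vertical.  The second half is the image of the first one under the
    reflection b |-> 2^(h+1) - 3 - b, which reverses the parity of b; it thus
    lives on the other branch above level 0. *)
Definition long_cycle (h j : nat) : Gam :=
  if (j <= h)%N then vtx (2 ^ j - 1) j
  else if (j < 2 * h)%N then vtx (2 ^ h.+1 - 1 - 2 ^ (2 * h - j)) (2 * h - j)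
  else if (j <= 3 * h)%N then vtx (2 ^ h.+1 - 2 - 2 ^ (j - 2 * h)) (j - 2 * h)
  else if (j < 4 * h)%N then vtx (2 ^ (4 * h - j) - 2) (4 * h - j)
  else vtx 0 0.

Section LongCycle.
Variable h : nat.
Hypothesis h1 : (1 < h)%N.

Lemma long_cycle1 i : (i <= h)%N -> long_cycle h i = vtx (2 ^ i - 1) i.
Proof. by rewrite /long_cycle => ->. Qed.

Lemma long_cycle2 i : (0 < i <= h)%N ->
  long_cycle h (2 * h - i) = vtx (2 ^ h.+1 - 1 - 2 ^ i) i.
Proof.
move=> ih; rewrite /long_cycle; case: ifP => [h'|_].
  have -> : i = h by lia.
  have -> : (2 * h - h = h)%N by lia.
  by congr vtx; rewrite expnS; lia.
by rewrite ifT; [congr vtx; [congr (_ - 2 ^ _)%N|]; lia|lia].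
Qed.

Lemma long_cycle3 i : (i <= h)%N ->
  long_cycle h (2 * h + i) = vtx (2 ^ h.+1 - 2 - 2 ^ i) i.
Proof.
move=> ih; rewrite /long_cycle; do 2! (rewrite ifF; last lia).
by rewrite ifT ?addKn //; lia.
Qed.

Lemma long_cycle4 i : (i <= h)%N -> long_cycle h (4 * h - i) = vtx (2 ^ i - 2) i.
Proof.
move=> ih; rewrite /long_cycle; do 2! (rewrite ifF; last lia).
have [->|i0] := posnP i; first by rewrite subn0 ltnn ifF ?expn0 //; lia.
case: ifP => [h'|_].
  have -> : i = h by lia.
  have -> : (4 * h - h - 2 * h = h)%N by lia.
  by rewrite expnS; congr vtx; lia.
by rewrite ifT; [congr vtx; [congr (2 ^ _ - 2)%N|]; lia|lia].
Qed.

Let pow_gt0 i : (0 < 2 ^ i)%N. Proof. by rewrite expn_gt0. Qed.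
Let pow_le i k : (i <= k)%N -> (2 ^ i <= 2 ^ k)%N.
Proof. by move=> ik; rewrite leq_exp2l. Qed.

Lemma long_cycle_adj j : (j < 4 * h)%N ->
  adj (long_cycle h j) (long_cycle h j.+1).
Proof.
move=> j4; have [jh|jh] := ltnP j h.
  rewrite (@long_cycle1 j) ?(@long_cycle1 j.+1) ?(ltnW jh) //.
  apply: vtx_adj; apply: Or32.
  by rewrite expnS; have := pow_gt0 j; lia.
have [j2|j2] := ltnP j (2 * h).
  have [i Ei] : exists i, i = (2 * h - j.+1)%N by exists (2 * h - j.+1)%N.
  have -> : j = (2 * h - i.+1)%N by lia.
  rewrite adj_sym (@long_cycle2 i.+1); last lia.
  have [i0|i0] := posnP i.
    have -> : (2 * h - i.+1).+1 = (2 * h + 0)%N by lia.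
    rewrite (@long_cycle3 0) // i0; apply: vtx_adj; apply: Or31.
    by rewrite expnS; lia.
  have -> : (2 * h - i.+1).+1 = (2 * h - i)%N by lia.
  rewrite (@long_cycle2 i); last lia.
  apply: vtx_adj; apply: Or33; have : (2 ^ i.+1 <= 2 ^ h)%N by apply: pow_le; lia.
  by rewrite !expnS; have := pow_gt0 h; lia.
have [j3|j3] := ltnP j (3 * h).
  have [i Ei] : exists i, i = (j - 2 * h)%N by exists (j - 2 * h)%N.
  have -> : j = (2 * h + i)%N by lia.
  rewrite -addnS (@long_cycle3 i) ?(@long_cycle3 i.+1); try lia.
  apply: vtx_adj; apply: Or33; have : (2 ^ i.+1 <= 2 ^ h)%N by apply: pow_le; lia.
  have : (2 ^ 1 <= 2 ^ h)%N by apply: pow_le; lia.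
  by rewrite !expnS expn0; lia.
have [i Ei] : exists i, i = (4 * h - j.+1)%N by exists (4 * h - j.+1)%N.
have -> : j = (4 * h - i.+1)%N by lia.
have -> : (4 * h - i.+1).+1 = (4 * h - i)%N by lia.
rewrite adj_sym (@long_cycle4 i) ?(@long_cycle4 i.+1); try lia.
apply: vtx_adj; have [->|i0] := posnP i; first exact: Or31.
apply: Or32; have : (2 ^ 1 <= 2 ^ i)%N by apply: pow_le.
by rewrite !expnS expn0; lia.
Qed.

Lemma long_cycle_far j r : (j < 2 * h)%N ->
  reach r (long_cycle h j) (long_cycle h (j + 2 * h)) -> (2 * h <= r)%N.
Proof.
move=> j2; have h4 : (2 ^ 2 <= 2 ^ h)%N by apply: pow_le.
have [jh|jh] := leqP j h.
  rewrite addnC (@long_cycle1 j) // (@long_cycle3 j) // => rr.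
  have le1 := pow_le jh; have p1 := pow_gt0 j.
  apply: (vtx_far rr).
    by move: h4; rewrite !expnS expn0; lia.
  have [jh'|ne] := eqVneq j h; [by left|right; left].
  have : (2 ^ j.+1 <= 2 ^ h)%N by apply: pow_le; lia.
  by rewrite !expnS; lia.
have [i Ei] : exists i, i = (2 * h - j)%N by exists (2 * h - j)%N.
have -> : j = (2 * h - i)%N by lia.
have -> : (2 * h - i + 2 * h = 4 * h - i)%N by lia.
rewrite (@long_cycle2 i); last lia.
rewrite (@long_cycle4 i); last lia.
have le1 : (2 ^ i.+1 <= 2 ^ h)%N by apply: pow_le; lia.
have p1 : (2 ^ 1 <= 2 ^ i)%N by apply: pow_le; lia.
move=> rr; apply: (vtx_far rr).
  by move: h4 le1 p1; rewrite !expnS expn0; lia.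
by right; right; move: h4 le1 p1; rewrite !expnS expn0; lia.
Qed.

End LongCycle.

Lemma not_shortcut_vertical : ~ shortcut R (cayley vertical_gens).
Proof.
move=> [theta bound]; pose h := theta.+2; pose n := (2 * (2 * h))%N.
have h1 : (1 < h)%N by [].
have n0 : (0 < n)%N by rewrite /n; lia.
have qn : long_cycle h n = long_cycle h 0.
  by rewrite /long_cycle /n /=; repeat case: ifP => ?; try lia; rewrite // expn0.
pose c := periodize n (long_cycle h).
have adjc i : adj (c i) (c (i + 1)).
  apply: (@periodize_rel _ n _ n0 qn (fun u v : Gam => adj u v)) => j jn.
  apply: long_cycle_adj => //.
  by move: jn; rewrite /n; lia.
suff iso : isometric_cycle n (@cycle_map R Gam c adjc).
  by have := bound _ _ iso; rewrite /n /h; lia.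
apply: cycle_map_isometric; first by rewrite /h; lia.
  exact: periodize_period.
move=> i r; have [j jn [k ->]] := periodize_ind n0 i.
have [small|big] := ltnP j (2 * h).
  have -> : j%:Z + k * n%:Z + (2 * h)%:Z = (j + 2 * h)%N%:Z + k * n%:Z.
    by rewrite PoszD; ring.
  rewrite /c !periodizeE // ?(ltnW jn) //; last by rewrite /n; lia.
  exact: long_cycle_far.
have -> : j%:Z + k * n%:Z + (2 * h)%:Z = (j - 2 * h)%N%:Z + (k + 1) * n%:Z.
  by rewrite /n; lia.
rewrite /c !periodizeE // ?(ltnW jn) //; last by rewrite /n; lia.
move=> /reach_sym; rewrite -{2}(subnK big); apply: long_cycle_far => //.
by move: jn; rewrite /n; lia.
Qed.

End HorocyclicCayley.

(** * Signed area *)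

Section Depth.
Variable R : realType.
Notation lev := (lev R).
Notation pos := (pos R).

Definition odd_pos (g : BS12) : bool := `[< exists z : int, pos g = z%:~R * 2 + 1 >].

(** The hyperbolic area of the sheet of odd abscissas, in the half plane with
    height y = 2^k, has density dx dy / y^2 and the primitive dx / y.  Since
    1 / y equals 1 at level 0, where this sheet is attached to the other ones,
    the primitive (1 / y - 1) dx extends by zero. *)
Definition depth (g : BS12) : R :=
  if (1 <= lev g) && odd_pos g then 2 ^ (- lev g) - 1 else 0.

Lemma odd_pos_eq g h (z : int) : pos h = pos g + z%:~R * 2 -> odd_pos h = odd_pos g.
Proof.
move=> e; apply/asboolP/asboolP => -[y Ey].
  by exists (y - z); move: Ey; rewrite e intrB; lra.
by exists (y + z); rewrite e Ey intrD; ring.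
Qed.

Lemma depth_low g : lev g < 1 -> depth g = 0.
Proof. by move=> h; rewrite /depth leNgt h. Qed.

Lemma depth_a g : depth (g * gen_a)%g = depth g.
Proof.
have l : lev (g * gen_a)%g = lev g by rewrite levM lev_a addr0.
have [g1|g1] := ltrP (lev g) 1; first by rewrite !depth_low ?l.
rewrite /depth l; congr (if _ && _ then _ else _).
apply: (@odd_pos_eq _ _ (2 ^+ `|lev g - 1|%N)).
rewrite posM pos_a mulr1 rmorphXn /=; congr (_ + _).
have {1}-> : lev g = `|lev g - 1|%N%:Z + 1 by lia.
by rewrite expfzDr ?pnatr_eq0 // expr1z.
Qed.

Lemma depth_t g : `|depth (g * gen_t)%g - depth g| <= 2 ^ (- lev g).
Proof.
have l : lev (g * gen_t)%g = lev g + 1 by rewrite levM lev_t.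
have p2 (k : int) : 0 < 2 ^ k :> R by rewrite exprz_gt0.
have o : odd_pos (g * gen_t)%g = odd_pos g.
  by apply: (@odd_pos_eq _ _ 0); rewrite posM pos_t mul0r mulr0.
have [g0|g0] := ltrP (lev g) 0.
  by rewrite !depth_low ?l ?subrr ?normr0 ?ltW //; lia.
rewrite /depth l o; case: (odd_pos g); last first.
  by rewrite !andbF subrr normr0 ltW.
have -> : 1 <= lev g + 1 by lia.
rewrite !andbT opprD expfzDr ?pnatr_eq0 // -[2 ^ (-1)]/(2^-1).
have := p2 (- lev g); case: (leP 1 (lev g)) => g1; first by rewrite ler_norml; lra.
have -> : lev g = 0 by lia.
by rewrite oppr0 expr0z ler_norml; lra.
Qed.

Definition box_move (C : R) (s : BS12) : Prop := forall g,
  [/\ `|pos (g * s)%g - pos g| <= C * 2 ^ lev g,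
      `|depth (g * s)%g - depth g| <= C * 2 ^ (- lev g) &
      2 ^ lev (g * s)%g <= C * 2 ^ lev g].

(** For the generators: a does not change the depth, as it preserves the branch,
    and t changes it by at most 2^-k; at level 0 the branch is entered, but
    there 2^-k - 1 vanishes. *)
Lemma depth_move s : exists2 C : R, 0 <= C &
  forall g, `|depth (g * s)%g - depth g| <= C * 2 ^ (- lev g).
Proof.
have p2 (k : int) : 0 < 2 ^ k :> R by rewrite exprz_gt0.
have comp x C : 0 <= C ->
    (forall g, `|depth (g * x)%g - depth g| <= C * 2 ^ (- lev g)) ->
    forall s, (exists2 C : R, 0 <= C &
      forall g, `|depth (g * s)%g - depth g| <= C * 2 ^ (- lev g)) ->
    exists2 C : R, 0 <= C &
      forall g, `|depth (g * (x * s))%g - depth g| <= C * 2 ^ (- lev g).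
  move=> C0 hC {}s [D D0 hD]; exists (C + D * 2 ^ (- lev x)).
    by rewrite addr_ge0 // mulr_ge0 // ltW.
  move=> g; have := hC g; have := hD (g * x)%g.
  rewrite levM opprD expfzDr ?pnatr_eq0 // mulgA => h1 h2.
  have -> : depth (g * x * s)%g - depth g =
    (depth (g * x * s)%g - depth (g * x)%g) + (depth (g * x)%g - depth g) by ring.
  by apply: le_trans (ler_normD _ _) _; lra.
elim/BS12_ind: s => [|s ih].
  by exists 0 => // g; rewrite mulg1 subrr normr0 mul0r.
split; apply: comp ih.
- exact: lexx 0.
- by move=> g; rewrite depth_a subrr normr0 mul0r.
- exact: lexx 0.
- by move=> g; rewrite -(depth_a (g / gen_a)%g) mulgVK subrr normr0 mul0r.
- exact: ler01.
- by move=> g; rewrite mul1r; exact: depth_t.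
- exact: ler0n R 2.
- move=> g; rewrite distrC -{1}(mulgVK gen_t g).
  apply: le_trans (depth_t _) _; rewrite levM levV lev_t opprD opprK.
  by rewrite expfzDr ?pnatr_eq0 // expr1z mulrC.
Qed.

(** Both coordinates scale with the level, in inverse ways, so that products
    of one increment in each direction are bounded independently of g. *)
Lemma box_move_ex s : exists C, box_move C s.
Proof.
have p2 (k : int) : 0 < 2 ^ k :> R by rewrite exprz_gt0.
have [C C0 hC] := depth_move s.
exists (`|pos s| + C + 2 ^ lev s) => g.
have X0 := p2 (lev g); have Y0 := p2 (- lev g); have Z0 := p2 (lev s).
have p0 := normr_ge0 (pos s); split.
- have -> : pos (g * s)%g - pos g = 2 ^ lev g * pos s by rewrite posM; ring.
  rewrite normrM (gtr0_norm X0) mulrC ler_wpM2r //; first exact: ltW.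
  by lra.
- apply: le_trans (hC g) _; rewrite ler_wpM2r //; first exact: ltW.
  by lra.
- rewrite levM expfzDr ?pnatr_eq0 // mulrC ler_wpM2r //; first exact: ltW.
  by lra.
Qed.

Lemma box_move_finite (T : set BS12) : finite_set T ->
  exists2 C, 0 < C & forall s, T s -> box_move C s.
Proof.
have p2 (k : int) : 0 < 2 ^ k :> R by rewrite exprz_gt0.
move=> /finite_seqP[l ->]; elim: l => [|s l [C C0 hC]].
  by exists 1 => // s; rewrite /= in_nil.
have [D hD] := box_move_ex s; exists (C + `|D|).
  by rewrite ltr_wpDr.
have mono c d r : c <= d -> box_move c r -> box_move d r.
  move=> cd h g; have [h1 h2 h3] := h g.
  by split; [apply: le_trans h1 _|apply: le_trans h2 _|apply: le_trans h3 _];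
    rewrite ler_wpM2r // ltW.
move=> r; rewrite /= inE => /orP[/eqP ->|rl].
  by apply: mono hD; rewrite ler_wpDl ?ler_norm // ltW.
by apply: mono (hC r rl); rewrite lerDl.
Qed.

End Depth.

(** Adjacent vertices are sent to points of a box whose shape depends on the
    vertex, through [scale], but whose area does not. *)
Section Area.
Variables (R : realType) (Gam : simple_graph) (x y scale : Gam -> R) (Lam : R).
Hypothesis Lam0 : 0 < Lam.
Hypothesis scale0 : forall u, 0 < scale u.
Hypothesis box : forall u v : Gam, adj u v ->
  [/\ `|x v - x u| <= Lam * scale u, `|y v - y u| <= Lam / scale u &
      scale v <= Lam * scale u].

(** Twice the signed area of the triangle spanned by 0, (x u, y u) and
    (x v, y v). *)
Definition cross (u v : Gam) : R := x u * y v - x v * y u.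

Fixpoint area (u : Gam) (s : seq Gam) : R :=
  if s is v :: s' then cross u v + area v s' else 0.

Lemma area_cat u s1 s2 : area u (s1 ++ s2) = area u s1 + area (last u s1) s2.
Proof. by elim: s1 u => [|v s1 ih] u /=; rewrite ?add0r // ih addrA. Qed.

Lemma area_rev u s : area (last u s) (rev (belast u s)) = - area u s.
Proof.
elim: s u => [|v s ih] u /=; first by rewrite oppr0.
rewrite rev_cons -cats1 area_cat ih last_rev_belast /= addr0 /cross.
by ring.
Qed.

Lemma walk_box n : exists2 C : R, 0 <= C & forall u s, path (@adj Gam) u s ->
  (size s <= n)%N -> `|x (last u s) - x u| <= C * scale u /\
                     `|y (last u s) - y u| <= C / scale u.
Proof.
elim: n => [|n [C C0 ih]].
  by exists 0 => // u [|//] _ _; rewrite /= !subrr normr0 !mul0r.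
exists (Lam + C * Lam); first by rewrite addr_ge0 ?mulr_ge0 // ltW.
move=> u [_ _|w s] /=.
  rewrite !subrr normr0; split; rewrite ?mulr_ge0 ?invr_ge0 ?addr_ge0 ?mulr_ge0 //;
  by rewrite ltW.
move=> /andP[uw ps] sn; have [hx hy] := ih w s ps sn.
have [bx by_ bk] := box uw; have [_ _ bk'] : [/\ True, True & scale u <= Lam * scale w].
  by split=> //; have [] := box (_ : adj w u); rewrite // adj_sym.
have bk'' : (scale w)^-1 <= Lam / scale u.
  by rewrite ler_pdivlMr // mulrC ler_pdivrMr.
split.
  have -> : x (last w s) - x u = (x (last w s) - x w) + (x w - x u) by ring.
  apply: le_trans (ler_normD _ _) _.
  by have := ler_wpM2l C0 bk; lra.
have -> : y (last w s) - y u = (y (last w s) - y w) + (y w - y u) by ring.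
apply: le_trans (ler_normD _ _) _.
by have := ler_wpM2l C0 bk''; lra.
Qed.

(** The polygon between the walk and its chord is a union of triangles with a
    vertex at u, each of them inside a box of bounded area. *)
Lemma area_chord n : exists2 C : R, 0 <= C & forall u s, path (@adj Gam) u s ->
  (size s <= n)%N -> `|area u s - cross u (last u s)| <= C.
Proof.
elim: n => [|n [C C0 ih]].
  by exists 0 => // u [|//] _ _; rewrite /= /cross subrr subr0 normr0.
have [D D0 hD] := walk_box n.+1.
exists (C + 2 * (Lam * D)); first by rewrite addr_ge0 ?mulr_ge0 // ltW.
move=> u [_ _|w s].
  by rewrite /= /cross subrr subr0 normr0 addr_ge0 ?mulr_ge0 // ltW.
move=> ps sn; have [hx hy] := hD u _ ps sn; move: ps sn hx hy => /=.
move=> /andP[uw ps] sn hx hy; have h := ih w s ps sn.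
have [bx by_ _] := box uw.
set v := last w s in h hx hy *.
have -> : cross u w + area w s - cross u v = (area w s - cross w v) +
    ((x w - x u) * (y v - y u) - (x v - x u) * (y w - y u)).
  by rewrite /cross; ring.
apply: le_trans (ler_normD _ _) _; apply: lerD => //.
apply: le_trans (ler_normB _ _) _; rewrite !normrM.
have k0 := scale0 u.
have e : Lam * D = Lam * scale u * (D / scale u) by field; rewrite gt_eqF.
have e' : Lam * D = D * scale u * (Lam / scale u) by field; rewrite gt_eqF.
have -> : 2 * (Lam * D) = Lam * D + Lam * D by ring.
by apply: lerD; [rewrite e|rewrite e']; apply: ler_pM.
Qed.

End Area.

(** * Polynomial area in strongly shortcut graphs *)

Section Polynomial.
Variables (R : realType) (Gam : simple_graph).
Local Notation vp := (@vertex_point R Gam).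

Lemma last_take_nth (u : Gam) s i : (i <= size s)%N ->
  last u (take i s) = nth u (u :: s) i.
Proof.
elim: s u i => [|v s ih] u [|i] //= si; rewrite ih //.
by case: i si => [|i] //= si; apply: set_nth_default.
Qed.

(** The cycle traced by the walk is not almost isometric, so it has antipodal
    points joined by a short path.  Rounding them to vertices costs a bounded amount,
    which the constant 3 absorbs. *)
Lemma short_chord (theta : nat) (xi : R) : connected_graph Gam -> 0 < xi < 1 ->
  (forall n f, @almost_isometric_cycle R Gam xi n f -> (n <= theta)%N) ->
  forall (u : Gam) s, path (@adj Gam) u s -> last u s = u ->
  (theta < size s)%N ->
  exists s1 s2 s3 r, [/\ s = s1 ++ s2 ++ s3,
    path (@adj Gam) (last u s1) r /\ last (last u s1) r = last (last u s1) s2,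
    (size s2 + size r)%:R <= (1 + xi) / 2 * (size s)%:R + 3 :> R &
    (size s1 + size s3 + size r)%:R <= (1 + xi) / 2 * (size s)%:R + 3 :> R].
Proof.
move=> conG /andP[xi0 xi1] bound u s ps ls big; pose n := size s.
have n0 : (0 < n)%N by rewrite /n; lia.
pose q j := nth u (u :: s) j.
have qn : q n = q 0%N by rewrite /q /n -[RHS]ls (last_nth u).
pose c := periodize n q.
have adjc i : adj (c i) (c (i + 1)).
  apply: (@periodize_rel _ n _ n0 qn (fun u v : Gam => adj u v)) => j jn.
  by rewrite /q /=; apply/(pathP u).
have per i : c (i + n%:Z) = c i by exact: periodize_period.
pose F := @cycle_map R Gam c adjc.
have Fper x (k : int) : F (x + k%:~R * n%:R) = F x by exact: cycle_map_periodz.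
pose N : R := n%:R; have N0 : 0 < N by rewrite ltr0n.
(* By periodicity and symmetry x may be taken in the first half, so that both
   points fall in one period. *)
have [x [x0 x2] [l pl ls']] : exists2 x, 0 <= x /\ x < N / 2 &
    exists2 l, segment_path (F x) (F (x + N / 2)) l & l < xi * (N / 2).
  have [x hx] : exists x, gdist (F x) (F (x + N / 2)) < xi * (N / 2).
    apply: contrapT => /forallNP no; suff : (n <= theta)%N by rewrite /n; lia.
    apply: (bound n F); split; first exact: cycle_mapP.
    by move=> x; rewrite leNgt; apply/negP; exact: no.
  have [l pl ls'] := gdist_lt (cycle_map_segment adjc _ _) hx.
  pose k := Num.floor (x / N); have /andP[k0 k1] := floorP (x / N).
  rewrite -/k in k0 k1; rewrite ler_pdivlMr // in k0.
  rewrite ltr_pdivrMr // mulrDl mul1r in k1.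
  have [small|large] := ltrP (x - k%:~R * N) (N / 2).
    exists (x - k%:~R * N); first by split=> //; lra.
    exists l => //; rewrite -(Fper _ k) -[X in segment_path _ X](Fper _ k).
    by move: pl; congr (segment_path (F _) (F _)); rewrite -/N; ring.
  exists (x - k%:~R * N - N / 2); first by split; lra.
  exists l => //; apply: segment_path_sym.
  rewrite -(Fper _ k) -[X in segment_path _ X](Fper _ (k + 1)) intrD.
  by move: pl; congr (segment_path (F _) (F _)); rewrite -/N; field.
have [i Ei] : exists i : nat, Num.floor x = i%:Z.
  have f0 : 0 <= Num.floor x by rewrite floor_ge_int.
  by exists `|Num.floor x|%N; rewrite gez0_abs.
have [j Ej] : exists j : nat, Num.floor (x + N / 2) = j%:Z.
  have f0 : 0 <= Num.floor (x + N / 2) by rewrite floor_ge_int; lra.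
  by exists `|Num.floor (x + N / 2)|%N; rewrite gez0_abs.
have /andP[i0 i1] := floorP x; have /andP[j0 j1] := floorP (x + N / 2).
rewrite Ei -pmulrn in i0 i1; rewrite Ej -pmulrn in j0 j1.
have jn : (j <= n)%N by rewrite -(ler_nat R) -/N; lra.
have ij : (i <= j)%N by rewrite -ltnS -(ltr_nat R) -natr1; lra.
have Fnat (k : nat) : (k <= n)%N -> F k%:R = vp (q k).
  move=> kn; rewrite -[k%:R]/(k%:Z%:~R) [LHS]cycle_map_int /c.
  by rewrite -(periodizeE qn 0 kn) mul0r addr0.
have pij : segment_path (vp (q i)) (vp (q j))
    (`|i%:R - x| + l + `|x + N / 2 - j%:R|).
  rewrite -(Fnat i) ?(leq_trans ij) // -(Fnat j) //.
  apply: segment_path_cat (cycle_map_segment adjc _ _).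
  by apply: segment_path_cat pl; exact: cycle_map_segment.
have [m ml [r [pr lr sr]]] := segment_reach conG pij.
have small1 : `|i%:R - x| <= 1 by rewrite ler_norml; lra.
have small2 : `|x + N / 2 - j%:R| <= 1 by rewrite ler_norml; lra.
have mxi : (size r)%:R <= xi * (N / 2) + 2.
  by have : (size r)%:R <= m%:R :> R; [rewrite ler_nat|lra].
have l1 : last u (take i s) = q i by apply: last_take_nth; exact: leq_trans jn.
have l2 : last (q i) (take (j - i) (drop i s)) = q j.
  by rewrite -l1 -last_cat -takeD subnKC //; exact: last_take_nth.
have sz2 : size (take (j - i) (drop i s)) = (j - i)%N.
  by rewrite size_takel // size_drop leq_sub2r.
have sz13 : (size (take i s) + size (drop j s) + (j - i) = n)%N.
  rewrite size_takel ?(leq_trans ij) // size_drop addnAC -[size s]/n.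
  by rewrite subnKC // subnKC.
have jiR : (j - i)%:R = j%:R - i%:R :> R by rewrite natrB.
exists (take i s), (take (j - i) (drop i s)), (drop j s), r; split.
- by rewrite catA -takeD subnKC // cat_take_drop.
- by rewrite l1 l2.
- by rewrite sz2 natrD jiR; lra.
- rewrite natrD; have : (size (take i s) + size (drop j s))%:R = N - (j%:R - i%:R).
    by rewrite -jiR /N -sz13 [in RHS]natrD; ring.
  by move=> ->; rewrite -/n -/N; lra.
Qed.

Variables (x y scale : Gam -> R) (Lam : R).
Hypothesis Lam0 : 0 < Lam.
Hypothesis scale0 : forall u, 0 < scale u.
Hypothesis box : forall u v : Gam, adj u v ->
  [/\ `|x v - x u| <= Lam * scale u, `|y v - y u| <= Lam / scale u &
      scale v <= Lam * scale u].
Local Notation area := (area x y).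

(** Both closed walks obtained by cutting along a short chord are
    shorter by the factor rho < 1.  If rho^k <= 1/2 then the bound C n^k is stable
    under cutting. *)
Lemma area_polynomial : connected_graph Gam -> strongly_shortcut R Gam ->
  exists (C : R) (k : nat), 0 <= C /\ forall u s, path (@adj Gam) u s ->
    last u s = u -> `|area u s| <= C * (size s)%:R ^+ k.
Proof.
move=> conG [theta [xi [xi01 bound]]]; have /andP[xi0 xi1] := xi01.
pose rho := (3 + xi) / 4.
have rho01 : 0 < rho < 1 by rewrite /rho; lra.
have [k hk] : exists k : nat, rho ^+ k <= 2^-1.
  have h2 : 0 < 2^-1 :> R by rewrite invr_gt0.
  have cv : (rho ^+ n) @[n --> \oo] --> (0 : R).
    by apply: cvg_expr; rewrite gtr0_norm; lra.
  have [k _ /(_ k (leqnn k))] := cvgr0_norm_le _ cv _ h2.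
  by move=> h; exists k; apply: le_trans h; exact: ler_norm.
have [M hM] : exists M : nat, 12 / (1 - xi) < M%:R.
  by exists (Num.truncn (12 / (1 - xi))).+1; exact: truncnS_gt.
pose N0 := (theta + M)%N.
have [C C0 hC] := area_chord Lam0 scale0 box N0.
exists C, k; split=> // u s; have [n sn] := ubnP (size s).
elim: n u s sn => // n ih u s; rewrite ltnS => sn ps ls.
have cl0 v : cross x y v v = 0 by rewrite /cross subrr.
have [->|s0] := eqVneq s [::].
  by rewrite /= normr0 mulr_ge0 // exprn_ge0.
have [small|big] := leqP (size s) N0.
  have := hC u s ps small; rewrite ls cl0 subr0 => /le_trans; apply.
  by rewrite ler_peMr // exprn_ege1 // ler1n lt0n size_eq0.
have [|s1 [s2 [s3 [r [Es [pr lr] sz1 sz2]]]]] := short_chord conG xi01 bound ps ls.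
  exact: leq_ltn_trans (leq_addr M theta) big.
have bigR : 12 / (1 - xi) < (size s)%:R.
  apply: lt_trans hM _; rewrite ltr_nat.
  exact: leq_ltn_trans (leq_addl theta M) big.
rewrite ltr_pdivrMr in bigR; last lra.
have less (m : nat) : m%:R <= (1 + xi) / 2 * (size s)%:R + 3 ->
    m%:R <= rho * (size s)%:R.
  by move=> h; rewrite /rho; lra.
have {}sz1 := less _ sz1; have {}sz2 := less _ sz2.
have lt_n (m : nat) : m%:R <= rho * (size s)%:R -> (m < n)%N.
  move=> h; apply: leq_trans sn; rewrite -(ltr_nat R); apply: le_lt_trans h _.
  by rewrite gtr_pMl ?ltr0n ?lt0n ?size_eq0 //; lra.
pose v := last u s1; pose v' := last v s2.
move: ps ls; rewrite Es !cat_path !last_cat -/v -/v' => /and3P[p1 p2 p3] ls.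
have loop1 : `|area v (s2 ++ rev (belast v r))| <=
    C * (size s2 + size r)%:R ^+ k.
  have -> : (size s2 + size r = size (s2 ++ rev (belast v r)))%N.
    by rewrite size_cat size_rev size_belast.
  apply: ih.
  - by rewrite size_cat size_rev size_belast; exact: lt_n.
  - by rewrite cat_path p2 -/v' /v' -lr path_rev.
  - by rewrite last_cat -/v' /v' -lr last_rev_belast.
have loop2 : `|area u (s1 ++ r ++ s3)| <=
    C * (size s1 + size s3 + size r)%:R ^+ k.
  have -> : (size s1 + size s3 + size r = size (s1 ++ r ++ s3))%N.
    by rewrite !size_cat addnAC -addnA.
  apply: ih.
  - have -> : (size (s1 ++ r ++ s3) = size s1 + size s3 + size r)%N.
      by rewrite !size_cat addnAC -addnA.
    exact: lt_n.
  - by rewrite !cat_path p1 -/v pr lr.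
  - by rewrite !last_cat -/v lr.
have -> : area u (s1 ++ s2 ++ s3) =
    area u (s1 ++ r ++ s3) + area v (s2 ++ rev (belast v r)).
  rewrite !area_cat -/v -/v' /v' -lr area_rev; ring.
apply: le_trans (ler_normD _ _) _.
have pw (m : nat) : m%:R <= rho * (size s)%:R ->
    C * m%:R ^+ k <= C / 2 * (size s)%:R ^+ k.
  move=> h; rewrite -mulrA ler_wpM2l //.
  apply: le_trans (_ : (rho * (size s)%:R) ^+ k <= _).
    by rewrite lerXn2r ?nnegrE // mulr_ge0 //; lra.
  by rewrite exprMn ler_wpM2r // exprn_ge0.
rewrite -Es; have := pw _ sz1; have := pw _ sz2; move: loop1 loop2.
by move: (_ ^+ k) (_ ^+ k) (_ ^+ k) => a b d; lra.
Qed.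

End Polynomial.

(** * Words of exponential area *)

(** With n + 1 = 2^(2i) and C < 2^q the exponents to compare are q + 2ik and
    2^(2i) - 1, and 2^(2i) > i^2. *)
Lemma exp_dominates (R : realType) (C : R) (k : nat) :
  exists2 n : nat, (0 < n)%N & C * n.+1%:R ^+ k < 2 ^+ n.
Proof.
have [q hq] : exists q : nat, C < 2 ^+ q.
  exists (Num.truncn C).+1; apply: lt_le_trans (truncnS_gt C) _.
  by rewrite -natrX ler_nat ltnW // ltn_expl.
pose i := (q + 2 * k + 2)%N; pose m := (2 ^ (2 * i))%N.
have mi : (i * i < m)%N.
  have ii : (i < 2 ^ i)%N by rewrite ltn_expl.
  by rewrite /m mul2n -addnn expnD; apply: ltn_mul.
have qm : (q + 2 * i * k < m)%N.
  by apply: leq_ltn_trans mi; rewrite /i; nia.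
have m1 : (q + 2 * i * k <= m.-1)%N by lia.
exists m.-1; first by move: m1; rewrite /i; lia.
rewrite prednK; last by lia.
apply: lt_le_trans (_ : 2 ^+ (q + 2 * i * k) <= _); last first.
  by rewrite ler_weXn2l // ler1n.
by rewrite /m exprD natrX -exprM ltr_pM2r // exprn_gt0.
Qed.

Section WordArea.
Variable R : realType.
Notation lev := (lev R).
Notation pos := (pos R).
Notation depth := (depth R).

Fixpoint word_area (g : BS12) (w : seq BS12) : R :=
  if w is s :: w' then
    pos g * depth (g * s)%g - pos (g * s)%g * depth g + word_area (g * s)%g w'
  else 0.

Lemma word_area_cat g w1 w2 : word_area g (w1 ++ w2) =
  word_area g w1 + word_area (foldl (fun x y => x * y)%g g w1) w2.
Proof. by elim: w1 g => [|s w ih] g /=; rewrite ?add0r // ih addrA. Qed.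

Lemma foldl_nseq (g s : BS12) n :
  foldl (fun x y => x * y)%g g (nseq n s) = (g * s ^+ n)%g.
Proof.
elim: n g => [|n ih] g /=; first by rewrite expg0 mulg1.
by rewrite ih expgS mulgA.
Qed.

Lemma word_area_vertical g s n : pos s = 0 ->
  word_area g (nseq n s) = pos g * (depth (g * s ^+ n)%g - depth g).
Proof.
move=> s0; elim: n g => [|n ih] g /=; first by rewrite expg0 mulg1 subrr mulr0.
by rewrite ih expgS mulgA posM s0 mulr0 addr0; ring.
Qed.

(** The commutator of t^n a t^-n and a: these elements commute, being
    translations, but the trajectory of the word runs around a region
    of exponential area. *)
Definition commutator_word (n : nat) : seq BS12 :=
  nseq n gen_t ++ gen_a :: nseq n gen_t^-1%g ++ gen_a ::
  nseq n gen_t ++ gen_a^-1%g :: nseq n gen_t^-1%g ++ [:: gen_a^-1%g].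

Lemma size_commutator_word n : size (commutator_word n) = (4 * n.+1)%N.
Proof. by rewrite /commutator_word; do 4! rewrite ?(size_cat, size_nseq) /=; lia. Qed.

Lemma depthE g (z : int) : 0 < lev g ->
  (pos g = z%:~R * 2 -> depth g = 0) /\ (pos g = z%:~R * 2 + 1 ->
   depth g = 2 ^ (- lev g) - 1).
Proof.
move=> g1; rewrite /depth gtz0_ge1 in g1 *; rewrite g1 /=; split=> e.
  case: ifP => // /asboolP[y]; rewrite e => Ey.
  have : (z * 2 : int)%:~R = (y * 2 + 1)%:~R :> R by rewrite intrD !intrM.
  by move/intr_inj; lia.
by rewrite ifT //; apply/asboolP; exists z.
Qed.

(** Only the second excursion, at abscissas 2^n + 1 and 1, has nonzero depth.  The
    trajectory in the plane is the boundary, run clockwise, of a rectangle of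
    width 2^n and height 1 - 2^-n. *)
Lemma word_area_commutator n : (0 < n)%N ->
  foldl (fun x y => x * y)%g 1%g (commutator_word n) = 1%g /\
  word_area 1%g (commutator_word n) = 2 * (1 - 2 ^+ n).
Proof.
move=> n0.
have pV : pos gen_t^-1%g = 0 by rewrite !affE mulr0 oppr0.
have lVX : lev (gen_t^-1 ^+ n)%g = - n%:Z by rewrite expVgn !affE; lia.
have pVX : pos (gen_t^-1 ^+ n)%g = 0 by rewrite expVgn !affE mulr0 oppr0.
have lX : lev (gen_t ^+ n)%g = n%:Z by rewrite !affE; lia.
have pX : pos (gen_t ^+ n)%g = 0 by rewrite !affE.
have paV : pos gen_a^-1%g = -1 by rewrite !affE oppr0 expr0z mulr1.
have laV : lev gen_a^-1%g = 0 by rewrite !affE oppr0.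
have step g s p k : pos g = p -> lev g = k ->
    pos (g * s)%g = p + 2 ^ k * pos s /\ lev (g * s)%g = k + lev s.
  by move=> <- <-; rewrite posM levM.
rewrite /commutator_word.
pose g1 : BS12 := (1 * gen_t ^+ n)%g.
have [p1 l1] := step 1%g (gen_t ^+ n)%g 0 0 (pos1 R) (lev1 R).
rewrite pX mulr0 addr0 in p1; rewrite lX add0r in l1; rewrite -/g1 in p1 l1.
pose g2 := (g1 * gen_a)%g; have [p2 l2] := step _ gen_a _ _ p1 l1.
rewrite pos_a mulr1 add0r in p2; rewrite lev_a addr0 in l2; rewrite -/g2 in p2 l2.
pose g3 := (g2 * gen_t^-1 ^+ n)%g; have [p3 l3] := step _ (gen_t^-1 ^+ n)%g _ _ p2 l2.
rewrite pVX mulr0 addr0 in p3; rewrite lVX subrr in l3; rewrite -/g3 in p3 l3.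
pose g4 := (g3 * gen_a)%g; have [p4 l4] := step _ gen_a _ _ p3 l3.
rewrite pos_a mulr1 expr0z in p4; rewrite lev_a addr0 in l4; rewrite -/g4 in p4 l4.
pose g5 := (g4 * gen_t ^+ n)%g; have [p5 l5] := step _ (gen_t ^+ n)%g _ _ p4 l4.
rewrite pX mulr0 addr0 in p5; rewrite lX add0r in l5; rewrite -/g5 in p5 l5.
pose g6 := (g5 * gen_a^-1)%g; have [p6 l6] := step _ gen_a^-1%g _ _ p5 l5.
rewrite paV mulrN1 addrAC subrr add0r in p6; rewrite laV addr0 in l6.
rewrite -/g6 in p6 l6.
pose g7 := (g6 * gen_t^-1 ^+ n)%g; have [p7 l7] := step _ (gen_t^-1 ^+ n)%g _ _ p6 l6.
rewrite pVX mulr0 addr0 in p7; rewrite lVX subrr in l7; rewrite -/g7 in p7 l7.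
have [p8 l8] := step _ gen_a^-1%g _ _ p7 l7.
rewrite paV mulrN1 expr0z subrr in p8; rewrite laV addr0 in l8.
have even : 2 ^ n%:Z = ((2 : int) ^+ n.-1)%:~R * 2 :> R.
  by rewrite rmorphXn /= -[n in LHS](prednK n0) -exprnP exprSr.
have n0' : 0 < n%:Z by [].
have d1 : depth g1 = 0.
  by apply: (depthE 0 _).1; rewrite ?l1 // p1 mul0r.
have d2 : depth g2 = 0.
  by apply: (depthE (2 ^+ n.-1) _).1; rewrite ?l2 // p2.
have d3 : depth g3 = 0 by rewrite depth_low // l3.
have d4 : depth g4 = 0 by rewrite depth_low // l4.
have d5 : depth g5 = 2 ^ (- n%:Z) - 1.
  by rewrite -l5; apply: (depthE (2 ^+ n.-1) _).2; rewrite ?l5 // p5 even.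
have d6 : depth g6 = 2 ^ (- n%:Z) - 1.
  by rewrite -l6; apply: (depthE 0 _).2; rewrite ?l6 // p6 mul0r add0r.
have d7 : depth g7 = 0 by rewrite depth_low // l7.
have d8 : depth (g7 * gen_a^-1)%g = 0 by rewrite depth_low // l8.
have d0 : depth 1%g = 0 by rewrite depth_low // lev1.
split.
  do 4! rewrite ?(foldl_cat, foldl_nseq) /=.
  by apply: (@BS12_ext R); rewrite ?p8 ?l8 ?pos1 ?lev1.
rewrite word_area_cat word_area_vertical ?pos_t // foldl_nseq -/g1 /= -/g2.
rewrite word_area_cat word_area_vertical // foldl_nseq -/g3 /= -/g4.
rewrite word_area_cat word_area_vertical ?pos_t // foldl_nseq -/g5 /= -/g6.
rewrite word_area_cat word_area_vertical // foldl_nseq -/g7 /=.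
rewrite pos1 p1 p2 p3 p4 p5 p6 p7 p8 d1 d2 d3 d4 d5 d6 d7 d8 -exprnP.
have -> : 2 ^ (- n%:Z) = (2 ^+ n)^-1 :> R by rewrite -exprnN.
have : (2 : R) ^+ n != 0 by rewrite expf_neq0 // pnatr_eq0.
by move: (2 ^+ n) => p p0; field.
Qed.

End WordArea.

(** * Geometric actions *)

(** A torsion element has level 0, hence is a translation. *)
Lemma BS12_torsion_free (R : realType) (g : BS12) n : (0 < n)%N ->
  (g ^+ n = 1)%g -> g = 1%g.
Proof.
move=> n0 gn; have l : lev R g = 0.
  have := congr1 (lev R) gn; rewrite levX lev1 => /eqP.
  by rewrite mulf_eq0 => /orP[/eqP //|]; lia.
apply: (@BS12_ext R); rewrite ?lev1 // pos1.
have pX m : pos R (g ^+ m)%g = m%:R * pos R g.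
  elim: m => [|m ih]; first by rewrite expg0 pos1 mul0r.
  by rewrite expgS posM l expr0z ih -natr1; ring.
have := congr1 (pos R) gn; rewrite pX pos1 => /eqP.
by rewrite mulf_eq0 pnatr_eq0 => /orP[|/eqP //]; lia.
Qed.

Section Geometric.
Variables (R : realType) (Gam : simple_graph) (A : graph_action BS12 Gam).
Hypothesis properA : proper_action R A.
Hypothesis cocompactA : cocompact_action R A.
Local Notation vp := (@vertex_point R Gam).

Lemma act_vp g v : act_point A g (vp v) = vp (A g v).
Proof. by apply: realization_eq => w /=; rewrite actVE. Qed.

Lemma finite_transporter (F : set Gam) : finite_set F ->
  finite_set [set g | exists v w, [/\ F v, F w & A g v = w]].
Proof.
move=> fF; have cK := finite_compact (finite_image vp fF).
apply: sub_finite_set (properA cK) => g [v [w [Fv Fw gv]]].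
exists (vp w); split; last by exists w.
by exists (vp v); [exists v|rewrite act_vp gv].
Qed.

(** Stabilisers are finite by properness and torsion-free. *)
Lemma free_action g v : A g v = v -> g = 1%g.
Proof.
move=> gv; apply: contrapT => g1.
have [s Es] := (finite_seqP _).1 (finite_transporter (finite_set1 v)).
have stab n : (g ^+ n)%g \in s.
  suff : [set g | exists x y, [/\ [set v] x, [set v] y & A g x = y]] (g ^+ n)%g.
    by rewrite Es.
  exists v, v; split=> //; elim: n => [|n ih]; first by rewrite expg0 act1.
  by rewrite expgS actM ih.
have inj : injective (fun n => (g ^+ n)%g).
  move=> i j; wlog ij : i j / (i < j)%N.
    by move=> h e; have [/h|/h|//] := ltngtP i j; [exact|move/(_ (esym e))].
  move=> e; exfalso; apply: g1; apply: (@BS12_torsion_free R _ (j - i)).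
    by rewrite subn_gt0.
  by rewrite expgnFr ?e ?mulgV // ltnW.
have us : uniq [seq (g ^+ n)%g | n <- iota 0 (size s).+1].
  by rewrite map_inj_uniq ?iota_uniq.
have sub : {subset [seq (g ^+ n)%g | n <- iota 0 (size s).+1] <= s}.
  by move=> _ /mapP[n _ ->].
by have := uniq_leq_size us sub; rewrite size_map size_iota ltnn.
Qed.

(** A translate of K contains the midpoint of a given edge, so that the same group
    element carries both end points into the finite set [near_vertices K].
    As only finitely many elements move a vertex of a finite set to another
    one, [p u] and [p v] are both at bounded distance of this element.  On the
    orbit of v0 the value of p is prescribed, which is consistent because the
    action is free. *)
Lemma coarse_inverse (v0 : Gam) : exists p : Gam -> BS12,
  (forall g, p (A g v0) = g) /\
  finite_set [set s | exists u v : Gam, adj u v /\ s = ((p u)^-1 * p v)%g].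
Proof.
have [K cK KA] := cocompactA; have fF := finite_near_vertices cK.
have cov (x : realization R Gam) : exists g,
    forall v, 2^-1 <= x v -> near_vertices K (A g^-1%g v).
  have [g _ [y Ky Ex]] : (\bigcup_(g in [set: BS12]) (act_point A g @` K)) x.
    by rewrite KA.
  by exists g => v; rewrite -Ex /=; exists y.
pose F := near_vertices K `|` [set v0].
have fF' : finite_set F by rewrite finite_setU; split=> //; exact: finite_set1.
have /choice[p hp] : forall v, exists g, F (A g^-1%g v) /\
    (forall h, A h v0 = v -> g = h).
  move=> v; have [[h hv]|no] := pselect (exists h, A h v0 = v).
    exists h; split; first by right; rewrite -hv -actM mulVg act1.
    move=> h' h'v; apply/divg1_eq/(@free_action _ v).
    by rewrite actM -{1}h'v -[X in A h X]actM mulVg act1.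
  have [g hg] := cov (vp v); exists g; split; last by move=> h hv; case: no; exists h.
  left; apply: hg; rewrite vpE eqxx invf_le1 //; lra.
exists p; split; first by move=> g; exact: (hp _).2.
have fT := finite_transporter fF'.
apply: sub_finite_set (finite_image2 (fun x y : BS12 => x^-1 * y)%g fT fT).
move=> _ [u [v [uv ->]]].
(* The midpoint gives one k for both end points of the edge. *)
have mid_subproof : is_point (fun w : Gam =>
    2^-1 * (w == u)%:R + (1 - 2^-1) * (w == v)%:R : R).
  by exists u, v, 2^-1; split=> //; [right|lra].
have [k hk] := cov (Point mid_subproof).
have nuv := negbTE (adj_neq uv).
have ku : near_vertices K (A k^-1%g u).
  by apply: hk; rewrite /= eqxx nuv mulr1 mulr0 addr0.
have kv : near_vertices K (A k^-1%g v).
  by apply: hk; rewrite /= [v == u]eq_sym eqxx nuv mulr1 mulr0 add0r; lra.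
exists (k^-1 * p u)%g.
  exists (A (p u)^-1%g u), (A k^-1%g u); split; [exact: (hp u).1|by left|].
  by rewrite -actM mulgK.
exists (k^-1 * p v)%g.
  exists (A (p v)^-1%g v), (A k^-1%g v); split; [exact: (hp v).1|by left|].
  by rewrite -actM mulgK.
by rewrite invgM invgK -!mulgA mulVKg.
Qed.

Hypothesis conG : connected_graph Gam.

Lemma act_walk g (u : Gam) s : path (@adj Gam) u s ->
  path (@adj Gam) (A g u) (map (A g) s) /\
  last (A g u) (map (A g) s) = A g (last u s).
Proof.
move=> ps; rewrite last_map; split=> //.
by rewrite path_map; apply: sub_path ps => x y; exact: act_adj.
Qed.

(** The commutator words are lifted to closed walks, letter by letter.  Each
    letter contributes a walk of bounded length, whose area differs by a bounded
    amount from the area of its chord.  The closed walks thus have linear length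
    and exponential area. *)
Lemma not_strongly_shortcut_graph : ~ strongly_shortcut R Gam.
Proof.
move=> ss; have [[v0] con] := conG.
have [p [pK fT]] := coarse_inverse v0.
have [Lam Lam0 hT] := box_move_finite R fT.
pose x v := pos R (p v); pose y v := depth R (p v); pose scale v : R := 2 ^ lev R (p v).
have scale0 v : 0 < scale v by rewrite exprz_gt0.
have box (u v : Gam) : adj u v ->
    [/\ `|x v - x u| <= Lam * scale u, `|y v - y u| <= Lam / scale u &
        scale v <= Lam * scale u].
  move=> uv; have [|h1 h2 h3] := hT ((p u)^-1 * p v)%g _ (p u).
    by exists u, v.
  by rewrite mulVKg in h1 h2 h3; split=> //; rewrite /scale invr_expz.
have [C [k [C0 poly]]] := area_polynomial Lam0 scale0 box conG ss.
(* Fixed walks from v0 to its images under the letters; translating them lifts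
   words. *)
pose letters : seq BS12 := [:: gen_a; gen_a^-1; gen_t; gen_t^-1]%g.
have [L hL] : exists L : nat, forall s, s \in letters ->
    exists w, [/\ path (@adj Gam) v0 w, last v0 w = A s v0 & (size w <= L)%N].
  elim: letters => [|s l [L ih]]; first by exists 0%N.
  have [w pw lw] := con v0 (A s v0); exists (maxn L (size w)) => s'.
  rewrite inE => /orP[/eqP ->|/ih[w' [pw' lw' sw']]].
    by exists w; rewrite leq_maxr.
  by exists w'; split=> //; rewrite leq_max sw'.
have [D D0 chord] := area_chord Lam0 scale0 box L.
have lift (w : seq BS12) g : {subset w <= letters} -> exists s,
    [/\ path (@adj Gam) (A g v0) s,
        last (A g v0) s = A (foldl (fun x y => x * y)%g g w) v0,
        (size s <= L * size w)%N &
        `|area x y (A g v0) s - word_area R g w| <= D * (size w)%:R].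
  elim: w g => [|l w ih] g wl.
    by exists [::]; rewrite /= subrr normr0 mulr0; split.
  have [|s [ps ls ss' as_]] := ih (g * l)%g.
    by move=> z zw; apply: wl; rewrite inE zw orbT.
  have [r [pr lr sr]] := hL l (wl _ (mem_head _ _)).
  have [pr' lr'] := act_walk g pr; rewrite lr -actM in lr'.
  exists (map (A g) r ++ s); rewrite cat_path last_cat lr'; split=> //.
  - by rewrite pr' ps.
  - by rewrite size_cat size_map mulnS leq_add.
  rewrite area_cat lr' /=.
  have := chord _ _ pr'; rewrite size_map lr' => /(_ sr).
  rewrite /cross /x /y !pK => h.
  rewrite -natr1 mulrDr mulr1.
  set a1 := area _ _ _ (map _ _) in h *; set a2 := area _ _ _ s in as_ *.
  set b := (X in `|a1 - X|) in h *.
  have -> : a1 + a2 - (b + word_area R (g * l)%g w) =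
    (a2 - word_area R (g * l)%g w) + (a1 - b) by ring.
  by apply: le_trans (ler_normD _ _) _; apply: lerD.
pose E := 4 * D + C * (L * 4)%:R ^+ k.
have [n n0 hn] := exp_dominates (E + 2) k.+1.
have [fold1 area1] := word_area_commutator R n0.
have [|s [ps ls sz ar]] := lift (commutator_word n) 1%g.
  move=> l; rewrite /commutator_word /letters !(mem_cat, inE, mem_nseq).
  case: (l == gen_a); case: (l == gen_a^-1)%g => //=; rewrite ?orbF ?andbF.
  by case: (l == gen_t); case: (l == gen_t^-1)%g => //=; rewrite ?andbF.
rewrite fold1 in ls; have closed := poly _ _ ps ls.
rewrite size_commutator_word in sz ar; rewrite area1 in ar.
have m1 : 1 <= n.+1%:R :> R by rewrite ler1n.
have b1 : C * (size s)%:R ^+ k <= C * (L * 4)%:R ^+ k * n.+1%:R ^+ k.+1.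
  rewrite -mulrA ler_wpM2l //.
  apply: le_trans (_ : (L * 4)%:R ^+ k * n.+1%:R ^+ k <= _).
    by rewrite -exprMn -natrM lerXn2r ?nnegrE ?ler0n // ler_nat -mulnA.
  rewrite ler_wpM2l ?exprn_ge0 ?ler0n // exprS.
  by rewrite ler_peMl ?exprn_ge0 // (le_trans ler01).
have b2 : D * (4 * n.+1)%:R <= 4 * D * n.+1%:R ^+ k.+1.
  rewrite natrM mulrA [D * _]mulrC ler_wpM2l ?mulr_ge0 //.
  by rewrite exprS ler_peMr ?exprn_ege1 // (le_trans ler01).
have p1 : 1 <= n.+1%:R ^+ k.+1 :> R by rewrite exprn_ege1.
move: ar closed hn b1 b2; rewrite /E.
move: (2 ^+ n) (_ ^+ k.+1) p1 => t m p1.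
move: (area _ _ _ _) => W; rewrite !ler_norml => /andP[h1 h2] /andP[h3 h4].
lra.
Qed.

End Geometric.

Theorem theoremD (R : realType) :
  [/\ shortcut_group R BS12,
      ~ strongly_shortcut_group R BS12,
      (exists S : seq BS12, generates S /\ shortcut R (cayley S)) &
      (exists S : seq BS12, generates S /\ ~ shortcut R (cayley S))].
Proof.
split.
- exact: shortcut_group_BS12.
- move=> [Gam [con ss [A [pA cA]]]].
  exact: (not_strongly_shortcut_graph pA cA con ss).
- by exists standard_gens; split; [exact: generates_standard|exact: shortcut_standard].
- by exists vertical_gens; split;
  [exact: generates_vertical|exact: not_shortcut_vertical].
Qed.
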